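(* Let $(M,g)$ be a smooth orientable Riemannian manifold of dimension $n$, let $q\ge 1$ be an integer, and let $(\phi,\Omega)$ be a chart on $M$ with coordinates $(x^1,\dots,x^n)$. Suppose $\alpha$ is an $L^1_{loc}$ differential $q$-form on $M$ that has a weak covariant derivative $\nabla\alpha=\tau$ on $M$ (in the sense defined in the context). Then $\alpha$ has weak first-order partial derivatives in the Euclidean sense in $\phi(\Omega)\subset\mathbb{R}^n$, i.e. each component function $\alpha_{i_1\dots i_q}\circ\phi^{-1}$ has weak partial derivatives of first order on $\phi(\Omega)$, and the weak covariant derivative has the same local coordinate representation as in the classical case with classical derivatives replaced by weak derivatives: in $\Omega$, for all $1\le i,i_1,\dots,i_q\le n$ and almost everywhere, $$\nabla_i\alpha_{i_1\dots i_q}=\partial_i\alpha_{i_1\dots i_q}-\sum_{\mu=1}^q\Gamma^l_{i i_\mu}\,\alpha_{i_1\dots i_{\mu-1}\,l\,i_{\mu+1}\dots i_q},$$ where the left-hand side denotes the component $\tau_{i i_1\dots i_q}$ of the weak covariant derivative and $\partial_i$ is the weak partial derivative in the coordinates of the chart.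
   Context: Repeated indices are summed (in the displayed formula, over $l$ for each $\mu$). $\nabla$ is the Levi-Civita connection of $g$, extended to covariant tensors, and $\Gamma^l_{ij}=\frac12 g^{lm}(\partial_i g_{jm}+\partial_j g_{im}-\partial_m g_{ij})$ are its Christoffel symbols. For a function $f$ on $\Omega$, $\partial_i f$ is the partial derivative $\partial_{x^i}(f\circ\phi^{-1})$ on $\phi(\Omega)$, pulled back to $\Omega$ by $\phi$. A $q$-form is regarded as an antisymmetric covariant $q$-tensor with components $\alpha_{i_1\dots i_q}$. The measure $\mathrm{Vol}_M$ is given in local coordinates by $\sqrt{\det g}\,dx^1\wedge\cdots\wedge dx^n$. For covariant $k$-tensors $S,T$, $g(S,T)=g^{i_1j_1}\cdots g^{i_kj_k}S_{i_1\dots i_k}T_{j_1\dots j_k}$. $L^1_{loc}$ means locally integrable. Index convention: the covariant derivative of a covariant $r$-tensor $T$ has components $(\nabla T)_{i i_1\dots i_r}=\nabla_i T_{i_1\dots i_r}$. Its formal adjoint $\nabla^*$ maps smooth covariant $(r+1)$-tensors to covariant $r$-tensors by $(\nabla^*\theta)_{i_1\dots i_r}=-g^{ij}\nabla_j\theta_{i i_1\dots i_r}$. Weak covariant derivative: an $L^1_{loc}$ $q$-form $\alpha$ has a weak covariant derivative if there exists an $L^1_{loc}$ covariant $(q+1)$-tensor field $\tau$ such that $$\int_M g(\tau,\theta)\,\mathrm{Vol}_M=\int_M g(\alpha,\nabla^*\theta)\,\mathrm{Vol}_M$$ for every smooth compactly supported covariant $(q+1)$-tensor field $\theta$; then $\tau$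 is the weak covariant derivative $\nabla\alpha$. *)

(* Defs.v *)
From HB Require Import structures.
From mathcomp Require Import all_boot all_order all_algebra.
From mathcomp Require Import fingroup perm.
From mathcomp Require Import all_classical all_reals all_analysis.

Set Implicit Arguments.
Unset Strict Implicit.
Unset Printing Implicit Defensive.

Import Order.TTheory GRing.Theory Num.Theory.
Import numFieldNormedType.Exports.

Local Open Scope classical_set_scope.
Local Open Scope ring_scope.

Notation borel T := (g_sigma_algebraType (@open T)).

(* n-dimensional Lebesgue measure on the Borel sets of 'rV[R]_n: iterate the
   product of one-dimensional Lebesgue measures on tuples, then transport to row
   vectors. *)
Section LebesgueMeasureRV.
Variable R : realType.
Local Notation mR := (measurableTypeR R).

Definition cons_pair n (x : mR * n.-tuple mR) : n.+1.-tuple mR :=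
  [the n.+1.-tuple mR of x.1 :: x.2].

Lemma measurable_cons_pair n : measurable_fun setT (@cons_pair n).
Proof. exact: measurable_cons. Qed.

Definition lebesgue_tuple0 : set (0.-tuple mR) -> \bar R := \d_[tuple].
HB.instance Definition _ := Measure.on lebesgue_tuple0.

Let lebesgue_tuple0_sigma_finite : sigma_finite setT lebesgue_tuple0.
Proof.
apply: fin_num_fun_sigma_finite; first by rewrite measure0.
by move=> A _; rewrite /lebesgue_tuple0 /dirac.
Qed.

HB.instance Definition _ := Measure_isSigmaFinite.Build _ _ _ lebesgue_tuple0
  lebesgue_tuple0_sigma_finite.

Section Step.
Variables (n : nat) (m : {sigma_finite_measure set (n.-tuple mR) -> \bar R}).

Definition lebesgue_tupleS : set (n.+1.-tuple mR) -> \bar R :=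
  pushforward (@lebesgue_measure R \x m)%E (@cons_pair n).

HB.instance Definition _ := Measure.copy lebesgue_tupleS
  [the {measure set _ -> \bar R} of
    measure_function_pushforward__canonical__measure_function_Measure
      (@lebesgue_measure R \x m)%E (@measurable_cons_pair n)].

Let lebesgue_tupleS_sigma_finite : sigma_finite setT lebesgue_tupleS.
Proof.
have [F FT Foo] : sigma_finite setT (@lebesgue_measure R \x m)%E.
  have /sigma_finiteP[F [TF ndF Foo]] := sigma_finiteT (@lebesgue_measure R).
  have /sigma_finiteP[G [TG ndG Goo]] := sigma_finiteT m.
  exists (fun k => F k `*` G k).
    rewrite -setXTT TF TG predeqE => -[x y]; split=> [[/= [i _ Fx] [j _ Gy]]|].
      exists (maxn i j) => //; split.
      - by move: x Fx; exact/subsetPset/ndF/leq_maxl.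
      - by move: y Gy; exact/subsetPset/ndG/leq_maxr.
    by move=> [k _ []/= ? ?]; split; exists k.
  move=> k; have [? ?] := Foo k; have [? ?] := Goo k.
  split; first exact: measurableX.
  by rewrite product_measure1E// lte_mul_pinfty// ge0_fin_numE.
pose u (t : n.+1.-tuple mR) : (mR * n.-tuple mR)%type :=
  (thead t, [tuple of behead t]).
have cu x : u (cons_pair x) = x.
  by case: x => a t; rewrite /u /cons_pair theadE; congr pair; exact: val_inj.
have mu : measurable_fun setT u.
  apply/measurable_fun_pairP; split; first exact: measurable_tnth.
  exact: measurable_behead.
exists (fun k => u @^-1` F k).
  by rewrite -preimage_bigcup -FT preimage_setT.
move=> k; have [mF Fk] := Foo k; split.
  by rewrite -[X in measurable X]setTI; exact: mu.
rewrite /lebesgue_tupleS /pushforward -comp_preimage.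
by rewrite (_ : u \o _ = id) ?preimage_id//; exact/funext.
Qed.

HB.instance Definition _ := Measure_isSigmaFinite.Build _ _ _ lebesgue_tupleS
  lebesgue_tupleS_sigma_finite.
End Step.

Fixpoint lebesgue_tuple n : {sigma_finite_measure set (n.-tuple mR) -> \bar R} :=
  if n is n'.+1 then lebesgue_tupleS (lebesgue_tuple n') else lebesgue_tuple0.

Definition row_of_tuple n (t : n.-tuple mR) : borel 'rV[R]_n :=
  \row_i tnth t i.

Lemma measurable_row_of_tuple n : measurable_fun setT (@row_of_tuple n).
Proof.
refine (@measurability _ _ _ (borel 'rV[R]_n) setT _ open _ _); first by [].
move=> _ [U oU <-].
rewrite setTI.
pose box (k : n.-tuple (rat * rat)) : set (n.-tuple mR) :=
  \bigcap_(i in [set: 'I_n])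
    (@tnth n mR ^~ i) @^-1` `]ratr (tnth k i).1, ratr (tnth k i).2[.
have mbox k : measurable (box k).
  apply: fin_bigcap_measurable => // i _.
  by rewrite -[X in measurable X]setTI; exact: measurable_tnth.
suff -> : @row_of_tuple n @^-1` U =
    \bigcup_(k in [set k | box k `<=` @row_of_tuple n @^-1` U]) box k.
  rewrite bigcup_mkcond; apply: countable_bigcupT_measurable => // k.
  by case: ifP.
apply/seteqP; split=> [t Ut|t [k kU /kU//]].
have /= [P Pt PU] : nbhs (row_of_tuple t) U by exact: open_nbhs_nbhs.
have H (i : 'I_n) : exists q : rat * rat,
    ratr q.1 < tnth t i < ratr q.2 /\
    `]ratr q.1, ratr q.2[ `<=` P ord0 i.
  have := Pt ord0 i; rewrite mxE => /nbhs_ballP[e /= e0 eP].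
  have et : tnth t i - e < tnth t i by rewrite ltrBlDr ltrDl.
  have te : tnth t i < tnth t i + e by rewrite ltrDl.
  have [a] := rat_in_itvoo et; have [b] := rat_in_itvoo te.
  rewrite !in_itv/= => /andP[tb be] /andP[ea at_].
  exists (a, b); split; first by rewrite /= at_ tb.
  move=> x /=; rewrite in_itv/= => /andP[ax xb]; apply: eP.
  rewrite /ball/= ltr_distlC.
  by rewrite (lt_trans ea)//= (lt_trans xb).
have [q Hq] := choice H.
exists [tuple q i | i < n].
  move=> s /= sb; apply: PU => i j.
  rewrite (ord1 i) mxE; apply: (Hq j).2; have := sb j I.
  by rewrite /= tnth_mktuple.
by move=> i _ /=; rewrite tnth_mktuple in_itv/=; exact: (Hq i).1.
Qed.

Definition lebesgue_rV n : set (borel 'rV[R]_n) -> \bar R :=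
  pushforward (lebesgue_tuple n) (@row_of_tuple n).

HB.instance Definition _ n := Measure.copy (@lebesgue_rV n)
  [the {measure set _ -> \bar R} of
    measure_function_pushforward__canonical__measure_function_Measure
      (lebesgue_tuple n) (@measurable_row_of_tuple n)].

Lemma lebesgue_rV_box n (a b : 'rV[R]_n) : (forall i, a 0 i <= b 0 i) ->
  lebesgue_rV [set x : 'rV[R]_n | forall i, x 0 i \in `[a 0 i, b 0 i]] =
  (\prod_(i < n) (b 0 i - a 0 i))%:E.
Proof.
suff H m (u v : 'I_m -> R) : (forall i, u i <= v i) ->
    measurable [set t : m.-tuple mR | forall i, tnth t i \in `[u i, v i]] /\
    lebesgue_tuple m [set t | forall i, tnth t i \in `[u i, v i]] =
    (\prod_(i < m) (v i - u i))%:E.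
  move=> ab; have [_ <-] := H n (a 0) (b 0) ab.
  rewrite /lebesgue_rV /pushforward; congr (lebesgue_tuple n _).
  by apply/seteqP; split=> t /= tab i; have := tab i; rewrite mxE.
elim: m u v => [|m IH] u v uv.
  have -> : [set t : 0.-tuple mR | forall i, tnth t i \in `[u i, v i]] = setT.
    by apply/seteqP; split=> t _ // [].
  split; first exact: measurableT.
  by rewrite big_ord0 /= /lebesgue_tuple0 diracT.
have [mB IHB] := IH (u \o lift ord0) (v \o lift ord0) (fun i => uv _).
set B := [set t | _] in mB IHB.
pose A : set (measurableTypeR R) := `[u ord0, v ord0]%classic.
have mA : measurable A by exact: measurable_itv.
have E (t : m.+1.-tuple mR) : (forall i, tnth t i \in `[u i, v i]) <->
    A (thead t) /\ B [tuple of behead t].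
  have tb (i : 'I_m) : tnth [tuple of behead t] i = tnth t (lift ord0 i).
    rewrite tnth_behead; congr tnth; apply: val_inj.
    by rewrite /= inordK// ltnS.
  split=> [tuv|[tA tB] i]; first by split=> [|i] /=; rewrite ?tb; exact: tuv.
  case: (unliftP ord0 i) => [j|] ->; last exact: tA.
  by rewrite -tb; exact: tB.
split.
  rewrite (_ : [set _ | _] = (@tnth _ mR ^~ ord0) @^-1` A `&`
      (fun t : m.+1.-tuple mR => [tuple of behead t]) @^-1` B); last first.
    by apply/seteqP; split=> t /= /E.
  apply: measurableI; rewrite -[X in measurable X]setTI.
    exact: measurable_tnth.
  exact: measurable_behead.
have LA : @lebesgue_measure R A = (v ord0 - u ord0)%:E.
  rewrite /A lebesgue_measure_itv/= lte_fin.
  by have := uv ord0; rewrite le_eqVlt => /predU1P[->|->]; rewrite ?ltxx ?subrr.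
rewrite big_ord_recl /= /lebesgue_tupleS /pushforward.
rewrite (_ : _ @^-1` _ = A `*` B).
  by rewrite product_measure1E// IHB EFinM -LA.
apply/seteqP; split=> [[x t] /= /E|[x t] /= [Ax Bt]].
  rewrite theadE => -[Ax]; rewrite (_ : [tuple of _] = t)//; exact: val_inj.
by apply/E; rewrite theadE; split => //; rewrite (_ : [tuple of _] = t)//;
  exact: val_inj.
Qed.

End LebesgueMeasureRV.

Section EuclideanNotions.
Variables (R : realType) (n : nat).
Implicit Types (U : set 'rV[R]_n) (f : 'rV[R]_n -> R).

Definition partial (i : 'I_n) f : 'rV[R]_n -> R := 'D_(delta_mx 0 i) f.

(* C^oo on U (meant for U open): every iterated partial derivative exists and is
   continuous at every point of U. *)
Definition smooth_on U f := forall (s : seq 'I_n) x, U x ->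
  {for x, continuous (foldr partial f s)} /\
  (forall i, derivable (foldr partial f s) x (delta_mx 0 i)).

Definition test_function U f := smooth_on setT f /\
  exists K, [/\ compact K, K `<=` U & forall x, ~ K x -> f x = 0].

End EuclideanNotions.

Definition L1loc_on (R : realType) (T : ptopologicalType)
    (mu : {measure set (borel T) -> \bar R}) (D : set T) (f : T -> R) :=
  measurable_fun (D : set (borel T)) (f : borel T -> R) /\
  forall K : set T, K `<=` D -> compact K ->
    (\int[mu]_(x in K) `|f x|%:E < +oo)%E.

(* v is an i-th weak partial derivative of f on the open set U *)
Definition weak_partial (R : realType) (n : nat) (U : set 'rV[R]_n) (i : 'I_n)
    (f v : 'rV[R]_n -> R) :=
  [/\ L1loc_on (@lebesgue_rV R n) U f, L1loc_on (@lebesgue_rV R n) U v &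
    forall psi, test_function U psi ->
      (\int[@lebesgue_rV R n]_(x in U) (f x * partial i psi x)%:E =
       - \int[@lebesgue_rV R n]_(x in U) (v x * psi x)%:E)%E].

(* A chart (cdom, cmap): only the values of cmap on cdom and of cinv on
   cmap @` cdom are meaningful. *)
Record chart (R : realType) (n : nat) (M : topologicalType) := Chart {
  cdom : set M;
  cmap : M -> 'rV[R]_n;
  cinv : 'rV[R]_n -> M;
  cdom_open : open cdom;
  cimg_open : open (cmap @` cdom);
  cmapK : forall p, cdom p -> cinv (cmap p) = p;
  cmap_continuous : {in cdom, continuous cmap};
  cinv_continuous : {in cmap @` cdom, continuous cinv} }.

Definition cimg R n M (c : @chart R n M) : set 'rV[R]_n := cmap c @` cdom c.

Definition coord R n M (c : @chart R n M) (i : 'I_n) (p : M) : R := cmap c p 0 i.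

(* partial derivative along the i-th coordinate of the chart c *)
Definition pderiv R n M (c : @chart R n M) (i : 'I_n) (f : M -> R) (p : M) : R :=
  partial i (f \o cinv c) (cmap c p).

Definition smooth_in_chart R n M (c : @chart R n M) (D : set M) (f : M -> R) :=
  smooth_on (cmap c @` (D `&` cdom c)) (f \o cinv c).

Definition smooth_transition R n M (c c' : @chart R n M) :=
  forall i, smooth_in_chart c (cdom c') (coord c' i).

(* Smooth manifolds are Hausdorff and second countable, and carry a maximal
   atlas, so that "a chart of M" is an element of the atlas. *)
Record smooth_manifold (R : realType) (n : nat) := SmoothManifold {
  carrier :> ptopologicalType;
  atlas : set (chart R n carrier);
  carrier_hausdorff : hausdorff_space carrier;
  carrier_second_countable : @second_countable carrier;
  atlas_cover : forall p, exists2 c, atlas c & cdom c p;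
  atlas_compat : forall c c', atlas c -> atlas c' -> smooth_transition c c';
  atlas_maximal : forall c,
    (forall c', atlas c' -> smooth_transition c c' /\ smooth_transition c' c) ->
    atlas c }.

Section Tensors.
Variables (R : realType) (n : nat) (M : smooth_manifold R n).
Local Notation chart := (chart R n M).
Implicit Types (c : chart) (p : M).

Definition chart_at p : chart := sval (cid2 (atlas_cover p)).

Definition jacobian_mx c c' p : 'M[R]_n :=
  \matrix_(a, b) pderiv c' b (coord c a) p.

Definition orientable := exists A : set chart,
  [/\ A `<=` @atlas _ _ M, forall p, exists2 c, A c & cdom c p &
    forall c c' p, A c -> A c' -> cdom c p -> cdom c' p ->
      0 < \det (jacobian_mx c c' p)].

(* A covariant k-tensor field is given by its components in all the charts
   (meaningful for c in the atlas, p in cdom c), subject to the usual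
   transformation law. *)
Definition components k := chart -> k.-tuple 'I_n -> M -> R.

Definition is_tensor k (T : components k) := forall c c' p,
  @atlas _ _ M c -> @atlas _ _ M c' -> cdom c p -> cdom c' p ->
  forall J : k.-tuple 'I_n,
    T c' J p = \sum_(I : k.-tuple 'I_n)
      (\prod_(a < k) jacobian_mx c c' p (tnth I a) (tnth J a)) * T c I p.

Definition smooth_tensor k (T : components k) :=
  is_tensor T /\
  forall c I, @atlas _ _ M c -> smooth_in_chart c (cdom c) (T c I).

Definition compactly_supported k (T : components k) :=
  exists2 K : set M, compact K &
    forall c I p, @atlas _ _ M c -> cdom c p -> ~ K p -> T c I p = 0.

Definition antisymmetric k (T : components k) :=
  forall c I p (s : 'S_k), @atlas _ _ M c -> cdom c p ->
    T c [tuple tnth I (s a) | a < k] p = (-1) ^+ s * T c I p.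

Definition is_form k (T : components k) := is_tensor T /\ antisymmetric T.

Record riemannian_metric := RiemannianMetric {
  metric : components 2;
  metric_smooth : smooth_tensor metric;
  metric_sym : forall c i j p, @atlas _ _ M c -> cdom c p ->
    metric c [tuple i; j] p = metric c [tuple j; i] p;
  metric_pos : forall c p (v : 'rV[R]_n), @atlas _ _ M c -> cdom c p -> v != 0 ->
    0 < \sum_i \sum_j metric c [tuple i; j] p * v 0 i * v 0 j }.

Variable g : riemannian_metric.

Definition metric_mx c p : 'M[R]_n := \matrix_(i, j) metric g c [tuple i; j] p.

Definition inv_metric c p : 'M[R]_n := invmx (metric_mx c p).

(* Gamma^l_{ij} with i, j the lower indices *)
Definition christoffel c (l i j : 'I_n) p : R :=
  2^-1 * \sum_m inv_metric c p l m *
    (pderiv c i (metric g c [tuple j; m]) p + pderiv c j (metric g c [tuple i; m]) p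
     - pderiv c m (metric g c [tuple i; j]) p).

(* I with its entry at position mu replaced by l *)
Definition subst_index k (I : k.-tuple 'I_n) (mu : 'I_k) (l : 'I_n) :
    k.-tuple 'I_n :=
  [tuple if a == mu then l else tnth I a | a < k].

Definition nabla k (T : components k) : components k.+1 := fun c J p =>
  let i := thead J in let I := [tuple of behead J] in
  pderiv c i (T c I) p -
  \sum_(mu < k) \sum_(l < n)
    christoffel c l i (tnth I mu) p * T c (subst_index I mu l) p.

Definition nabla_star k (T : components k.+1) : components k := fun c I p =>
  - \sum_i \sum_j inv_metric c p i j * nabla T c [tuple of j :: i :: I] p.

(* g(S, T) at p, computed in some chart around p *)
Definition tensor_inner k (S T : components k) p : R :=
  let c := chart_at p in
  \sum_(I : k.-tuple 'I_n) \sum_(J : k.-tuple 'I_n)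
    (\prod_(a < k) inv_metric c p (tnth I a) (tnth J a)) * S c I p * T c J p.

(* Vol is the Riemannian volume: it is given in every chart by
   sqrt(det g) dx^1 ... dx^n. *)
Definition riemannian_volume (Vol : {measure set (borel M) -> \bar R}) :=
  forall c, @atlas _ _ M c ->
  forall B : set (borel 'rV[R]_n), measurable B ->
    Vol (cdom c `&` cmap c @^-1` B) =
    (\int[@lebesgue_rV R n]_(x in cimg c `&` B)
      (Num.sqrt (\det (metric_mx c (cinv c x))))%:E)%E.

Variable Vol : {measure set (borel M) -> \bar R}.

(* locally integrable tensor: its components in every chart are *)
Definition L1loc_tensor k (T : components k) := is_tensor T /\
  forall c I, @atlas _ _ M c -> L1loc_on Vol (cdom c) (T c I).

Definition weak_covariant_derivative k (alpha : components k)
    (tau : components k.+1) :=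
  L1loc_tensor tau /\
  forall theta : components k.+1,
    smooth_tensor theta -> compactly_supported theta ->
    (\int[Vol]_p (tensor_inner tau theta p)%:E =
     \int[Vol]_p (tensor_inner alpha (nabla_star theta) p)%:E)%E.

End Tensors.

(* Main.v *)
From HB Require Import structures.
Require Import Defs.
From mathcomp Require Import all_boot all_order all_algebra.
From mathcomp Require Import fingroup perm.
From mathcomp Require Import all_classical all_reals all_analysis.
From mathcomp Require Import measurable_realfun.
From mathcomp Require Import ring lra.

(** The weak derivative sought for is forced by the coordinate formula: it is the
    component [tau_(i I)] of the weak covariant derivative plus the Christoffel
    terms in the components of [alpha], read in the chart.  With this choice the
    coordinate formula is an identity, and what has to be shown is that this
    function is locally integrable and is the [i]-th weak partial derivative of
    the component [alpha_I].

    Given a test function [psi] on the image of the chart, insert into the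
    definition of the weak covariant derivative the tensor field which has, with
    raised indices and in the chart, the single component [psi / sqrt (det g)] at
    position [i :: I] ([test_tensor]).  It extends by zero to a smooth compactly
    supported tensor field on the manifold ([test_tensor_smooth]).  In the chart
    the volume is [sqrt (det g)] times the Lebesgue measure ([integral_chart]), so
    that one side of the defining identity becomes the Lebesgue integral of
    [tau_(i I) * psi] ([tensor_inner_test]).  On the other side stands the
    divergence of the test tensor.  As the connection is metric
    ([christoffel2_metric]), lowering indices commutes with covariant
    differentiation, and the divergence involves the derivative of [psi], the
    Christoffel terms of [alpha], and the trace of the Christoffel symbols
    ([tinner_divergence]); by Jacobi's formula this trace is the logarithmic
    derivative of [sqrt (det g)] ([vol_density_is_derive]) and cancels.  The other
    side is therefore minus the integral of [alpha_I] times the derivative of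
    [psi] plus the Christoffel terms times [psi]
    ([tensor_inner_nabla_star_test]), and rearranging gives the claim.

    The pairing of tensors and the adjoint of the covariant derivative are
    computed at every point in an arbitrary chart, so the computation in the given
    chart rests on their invariance ([tensor_inner_chart], [nabla_star_tensor]).
    For the adjoint this is the transformation law of the Christoffel symbols
    ([christoffel2_pull]), which uses the symmetry of the second derivatives of
    the transition maps ([mixed_derive_eq]).  Local integrability passes from the
    manifold to the chart and back because continuous functions, such as the
    density, its inverse and the Christoffel symbols, are bounded on compact sets
    ([L1loc_onM], [L1loc_chart]). *)

Set Implicit Arguments.
Unset Strict Implicit.
Unset Printing Implicit Defensive.

Import Order.TTheory GRing.Theory Num.Theory.
Import numFieldNormedType.Exports.

Local Open Scope classical_set_scope.
Local Open Scope ring_scope.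


(** * Mean values, mixed derivatives, differentiability *)

Lemma linear_approx_differentiable (R : realType) (V W : normedModType R)
    (f : V -> W) (df : {linear V -> W}) x : continuous df ->
  (forall e : R, 0 < e ->
    \forall h \near 0, `|f (h + x) - (f x + df h)| <= e * `|h|) ->
  differentiable f x.
Proof.
move=> cdf H; suff E : f \o shift x = cst (f x) + df +o_ 0 id.
  by apply/diff_locallyP; rewrite (diff_unique cdf E).
exact/eqaddoP.
Qed.

Section MeanValue.
Variables (R : realType) (V : normedModType R).
Implicit Types (f : V -> R) (x y v w : V).

Lemma is_derive_line f y v (s : R) : derivable f (y + s *: v) v ->
  is_derive s 1 (fun r : R => f (y + r *: v)) ('D_v f (y + s *: v)).
Proof.
move=> df; have E : (fun h : R => h^-1 *: (((fun r : R => f (y + r *: v)) \o shift s)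
     (h *: (1 : R)) - f (y + s *: v))) =
     (fun h : R => h^-1 *: ((f \o shift (y + s *: v)) (h *: v) - f (y + s *: v))).
  apply/funext => h /=; congr (_ *: (f _ - _)).
  by rewrite [h%:A]mulr1 scalerDl addrCA.
by apply: DeriveDef; rewrite /derivable /derive E.
Qed.

Lemma mean_value_line f (df : R -> R) y v (t : R) :
  (forall s : R, `|s| <= `|t| -> is_derive (y + s *: v) v f (df s)) ->
  exists2 s : R, `|s| <= `|t| & f (y + t *: v) - f y = t * df s.
Proof.
move=> dfs; pose g (r : R) := f (y + r *: v).
have dg (s : R) : `|s| <= `|t| -> is_derive s 1 g (df s).
  by move=> /dfs[d <-]; exact: is_derive_line.
have cg (a b : R) : (forall s, s \in `[a, b] -> `|s| <= `|t|) ->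
    {within `[a, b], continuous g}.
  move=> ab; apply: derivable_within_continuous => s /ab /dg ds.
  by case: ds.
have g0 : f y = g 0 by rewrite /g scale0r addr0.
rewrite -[f (y + t *: v)]/(g t) g0.
have [t0|t0] := leP 0 t.
- have H s : s \in `[0, t] -> `|s| <= `|t|.
    by rewrite in_itv/= => /andP[s0 st]; rewrite !ger0_norm.
  have [s|c /H ct ->] := MVT_segment (df := df) t0 _ (cg _ _ H).
    by move=> /subset_itv_oo_cc /H/dg.
  by exists c => //; rewrite subr0 mulrC.
- have H s : s \in `[t, 0] -> `|s| <= `|t|.
    rewrite in_itv/= => /andP[s0 st]; rewrite (ler0_norm st) ltr0_norm//.
    by rewrite lerN2.
  have [s|c /H ct E] := MVT_segment (df := df) (ltW t0) _ (cg _ _ H).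
    by move=> /subset_itv_oo_cc /H/dg.
  by exists c => //; rewrite -[LHS]opprB E sub0r mulrN opprK mulrC.
Qed.

Lemma is_derive_shiftv f x v w d : is_derive (x + w) v f d ->
  is_derive x v (fun y => f (y + w)) d.
Proof.
move=> [df <-]; have E : (fun h : R => h^-1 *: (((fun y => f (y + w)) \o shift x)
     (h *: v) - f (x + w))) =
     (fun h : R => h^-1 *: ((f \o shift (x + w)) (h *: v) - f (x + w))).
  by apply/funext => h /=; rewrite addrA.
by apply: DeriveDef; rewrite /derivable /derive E.
Qed.

Lemma second_difference f fv fvw x v w (t : R) :
  (forall s r : R, `|s| <= `|t| -> `|r| <= `|t| ->
     is_derive (x + s *: v + r *: w) v f (fv (x + s *: v + r *: w)) /\
     is_derive (x + s *: v + r *: w) w fv (fvw (x + s *: v + r *: w))) ->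
  exists s r : R, [/\ `|s| <= `|t|, `|r| <= `|t| &
    f (x + t *: v + t *: w) - f (x + t *: v) - f (x + t *: w) + f x =
    t * (t * fvw (x + s *: v + r *: w))].
Proof.
move=> d; pose g y := f (y + t *: w) - f y.
have t0 : `|0 : R| <= `|t| by rewrite normr0.
have dg (s : R) : `|s| <= `|t| -> is_derive (x + s *: v) v g
    (fv (x + s *: v + t *: w) - fv (x + s *: v)).
  move=> st; have [/is_derive_shiftv a _] := d s t st (lexx _).
  have [b _] := d s 0 st t0; rewrite scale0r addr0 in b.
  exact: is_deriveB.
have [s st E] := mean_value_line dg.
have [r rt E'] := mean_value_line (fun r rt => (d s r st rt).2).
by exists s, r; split => //; rewrite -E' -E /g; ring.
Qed.

(** Schwarz's theorem.  The second difference of [f] over a parallelogram with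
    sides [t *: v] and [t *: w] is [t ^+ 2] times either mixed derivative at
    some point of it; let [t] tend to [0]. *)
Lemma mixed_derive_eq f fv fw fvw fwv x v w :
  (\forall y \near x, [/\ is_derive y v f (fv y), is_derive y w f (fw y),
     is_derive y w fv (fvw y) & is_derive y v fw (fwv y)]) ->
  {for x, continuous fvw} -> {for x, continuous fwv} -> fvw x = fwv x.
Proof.
move=> nd c1 c2.
apply/eqP; rewrite -subr_eq0 -normr_le0; apply/ler_addgt0Pl => e e0.
rewrite addr0.
have e2 : 0 < e / 2 by rewrite divr_gt0.
have /cvgrPdist_lt /(_ _ e2) n1 := c1.
have /cvgrPdist_lt /(_ _ e2) n2 := c2.
have : \forall y \near x,
   [/\ is_derive y v f (fv y), is_derive y w f (fw y),
     is_derive y w fv (fvw y) & is_derive y v fw (fwv y)] /\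
   (`|fvw x - fvw y| < e / 2 /\ `|fwv x - fwv y| < e / 2).
  by apply: filterI nd _; apply: filterI n1 n2.
move=> /nbhs_normP[d /= d0 H].
(* small enough for the parallelogram to lie in the ball of radius [d]; the
   [+ 1] keeps the denominator positive *)
pose t := d / 2 / (`|v| + `|w| + 1).
have t0 : 0 < t by rewrite divr_gt0 ?divr_gt0// ltr_wpDl// addr_ge0.
have near_x (u1 u2 : V) (s r : R) : `|u1| + `|u2| = `|v| + `|w| ->
    `|s| <= `|t| -> `|r| <= `|t| -> `|x - (x + s *: u1 + r *: u2)| < d.
  move=> u12; rewrite (gtr0_norm t0) => st rt.
  rewrite -addrA opprD addrA subrr sub0r normrN.
  apply: (le_lt_trans (ler_normD _ _)); rewrite !normrZ.
  apply: (@le_lt_trans _ _ (t * `|u1| + t * `|u2|)).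
    by apply: lerD; apply: ler_wpM2r.
  rewrite -mulrDr u12 /t; set a := `|v| + `|w|.
  have a0 : 0 <= a by rewrite addr_ge0.
  rewrite mulrAC ltr_pdivrMr ?ltr_wpDl//.
  have := mulr_ge0 (ltW d0) a0; nra.
have [s r st rt|s [r [st rt E1]]] := @second_difference f fv fvw x v w t.
  by have [[]] := H _ (near_x v w s r erefl st rt).
have [s' r' st' rt'|s' [r' [st' rt' E2]]] := @second_difference f fw fwv x w v t.
  by have [[]] := H _ (near_x w v s' r' (addrC _ _) st' rt').
have [_ [h1 _]] := H _ (near_x v w s r erefl st rt).
have [_ [_ h2]] := H _ (near_x w v s' r' (addrC _ _) st' rt').
have E : fvw (x + s *: v + r *: w) = fwv (x + s' *: w + r' *: v).
  have tn0 : t != 0 by rewrite gt_eqF.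
  apply/(mulfI tn0)/(mulfI tn0); rewrite -E1 -E2 [x + t *: w + _]addrAC; ring.
rewrite E in h1.
rewrite [e in _ <= e]splitr.
set a := fvw x in h1 *; set b := fwv x in h2 *; set m := fwv _ in h1 h2.
rewrite (_ : a - b = (a - m) - (b - m)); last by ring.
by apply: (le_trans (ler_normB _ _)); apply: lerD; exact: ltW.
Qed.
End MeanValue.

Section ContinuousPartials.
Variables (R : realType) (n : nat).
Implicit Types (f : 'rV[R]_n -> R) (x h : 'rV[R]_n).

Lemma row_norm_ge h i : `|h 0 i| <= `|h|.
Proof.
rewrite [leRHS]/Num.norm/= mx_normrE.
exact: (le_bigmax _ (fun ij : 'I_1 * 'I_n => `|h ij.1 ij.2|) (0, i)).
Qed.

Lemma row_norm_le h (e : R) : 0 <= e -> (forall i, `|h 0 i| <= e) -> `|h| <= e.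
Proof.
move=> e0 he; rewrite [leLHS]/Num.norm/= mx_normrE.
by apply/bigmax_leP; split => // -[i j] _ /=; rewrite (ord1 i).
Qed.

(** The increment of [f] is a telescoping sum of increments parallel to the
    coordinate axes, and each of them is given by the mean value theorem. *)
Lemma continuous_partials_differentiable f x :
  (\forall y \near x, forall i, derivable f y (delta_mx 0 i)) ->
  (forall i, {for x, continuous (partial i f)}) -> differentiable f x.
Proof.
move=> df cf.
pose L h : R := \sum_(i < n) h 0 i * partial i f x.
have linL : linear L.
  move=> a u v; rewrite /L scaler_sumr -big_split/=; apply: eq_bigr => i _.
  by rewrite !mxE /GRing.scale/=; ring.
pose LL := GRing.isLinear.Build _ _ _ _ _ linL.
pose Lf : {linear 'rV[R]_n -> R} := HB.pack L LL.
have cL : continuous Lf.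
  rewrite (_ : (Lf : _ -> _) = \sum_(i < n) (fun h => h 0 i * partial i f x)); last first.
    by apply/funext => h; rewrite fct_sumE.
  move=> h; apply: differentiable_continuous; apply: differentiable_sum => i.
  by apply: differentiableM => //; exact: differentiable_coord.
apply: (@linear_approx_differentiable _ _ R^o f Lf x cL) => _/posnumP[e].
have e' : 0 < e%:num / n.+1%:R by rewrite divr_gt0.
have : \forall y \near x, (forall i : 'I_n, derivable f y (delta_mx 0 i)) /\
    (forall i, `|partial i f x - partial i f y| < e%:num / n.+1%:R).
  have H : \forall y \near x, forall i, `|partial i f x - partial i f y| < e%:num / n.+1%:R.
    apply: (filter_forall (nbhs_filter x)) => i.
    by have /cvgrPdist_lt /(_ _ e') := cf i.
  exact: filterI df H.
move=> /nbhs_normP[d /= d0 nearH].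
have H y i (xy : `|x - y| < d) : derivable f y (delta_mx 0 i) /\
    `|partial i f x - partial i f y| < e%:num / n.+1%:R.
  by have [? ?] := nearH _ xy; split.
apply/nbhs_normP; exists d => //= h; rewrite /ball_ /= sub0r normrN => hd.
(* [p k] is [h] with all coordinates from the [k]-th on set to [0] *)
pose p k : 'rV[R]_n := \row_j if (j < k)%N then h 0 j else 0.
have pS (k : 'I_n) : p k.+1 = p k + h 0 k *: delta_mx 0 k.
  apply/rowP => j; rewrite !mxE eqxx /= ltnS leq_eqVlt.
  have [->|jk] := eqVneq j k; first by rewrite eqxx ltnn mulr1 add0r.
  by rewrite -val_eqE in jk; rewrite (negbTE jk)/= mulr0 addr0.
have p0 : p 0%N = 0 by apply/rowP => j; rewrite !mxE.
have pn : p n = h by apply/rowP => j; rewrite !mxE ltn_ord.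
have pk (k : 'I_n) (s : R) : `|s| <= `|h 0 k| ->
    `|x - (x + p k + s *: delta_mx 0 k)| < d.
  move=> sk; rewrite -addrA opprD addrA subrr sub0r normrN.
  apply: le_lt_trans hd; apply: row_norm_le => // j; rewrite !mxE eqxx/=.
  have [->|jk] := eqVneq j k; last first.
    rewrite mulr0 addr0; case: ifP => // _; first exact: row_norm_ge.
    by rewrite normr0.
  by rewrite ltnn add0r mulr1 (le_trans sk)// row_norm_ge.
have step (k : 'I_n) : `|f (x + p k.+1) - f (x + p k) - h 0 k * partial k f x| <=
    e%:num / n.+1%:R * `|h|.
  have dk (s : R) : `|s| <= `|h 0 k| ->
      is_derive (x + p k + s *: delta_mx 0 k) (delta_mx 0 k) f
        (partial k f (x + p k + s *: delta_mx 0 k)).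
    by move=> /pk /(H _ k)[/derivableP].
  have [s sk E] := mean_value_line dk.
  rewrite pS addrA E -mulrBr normrM mulrC ler_pM//.
    by rewrite distrC ltW//; have [] := H _ k (pk _ _ sk).
  exact: row_norm_ge.
have -> : f (h + x) - (f x + L h) =
    \sum_(k < n) (f (x + p k.+1) - f (x + p k) - h 0 k * partial k f x).
  rewrite big_split/= sumrN -(big_mkord xpredT (fun k => f (x + p k.+1) - f (x + p k))).
  by rewrite telescope_sumr// p0 pn addr0 [h + x]addrC opprD addrA.
apply: (le_trans (ler_norm_sum _ _ _)).
apply: (le_trans (ler_sum _ (fun k _ => step k))).
rewrite sumr_const card_ord -[leLHS]mulr_natl mulrA ler_wpM2r//.
by rewrite mulrCA ger_pMr// ler_pdivrMr// mul1r ler_nat.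
Qed.
End ContinuousPartials.

(** * Chain and product rules *)

Section ChainRule.
Variables (R : realType).

(** Directional derivatives are ordinary derivatives along a line: this reduces
    the rules below to those for functions of one real variable. *)
Lemma is_derive_lineP (V W : normedModType R) (f : V -> W) x v d :
  is_derive x v f d <-> is_derive (0 : R) (1 : R) (fun h => f (h *: v + x)) d.
Proof.
have E : 'D_v f x = 'D_1 (fun h : R => f (h *: v + x)) (0 : R).
  have E : (fun h : R => h^-1 *: ((f \o shift x) (h *: v) - f x)) =
           (fun h : R => h^-1 *: (((fun h : R => f (h *: v + x)) \o shift (0 : R))
              (h *: (1 : R)) - f ((0 : R) *: v + x))).
    by apply/funext => h /=; rewrite addr0 scale0r add0r [h%:A]mulr1.
  by rewrite /derive E.
split=> -[d1 d2].
  by apply: DeriveDef; [exact: (derivable1P _ _ _).1 d1|rewrite -E].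
by apply: DeriveDef; [exact: (derivable1P _ _ _).2 d1|rewrite E].
Qed.

Lemma is_derive_comp1 (V : normedModType R) (s : R -> R) (f : V -> R) x v (d e : R) :
  is_derive x v f d -> is_derive (f x) 1 s e -> is_derive x v (s \o f) (d * e).
Proof.
move=> /is_derive_lineP df ds; apply/is_derive_lineP.
pose g (h : R) := f (h *: v + x).
have g0 : g 0 = f x by rewrite /g scale0r add0r.
rewrite -g0 in ds.
have [d1 d2] := @is_derive1_comp _ s g 0 _ _ ds df.
by apply: DeriveDef; [exact: d1|rewrite -[RHS]mulrC -d2].
Qed.

Lemma diff_partial m (f : 'rV[R]_m -> R) y w : differentiable f y ->
  'd f y w = \sum_(a < m) w 0 a * partial a f y.
Proof.
move=> df; rewrite {1}(row_sum_delta w) linear_sum /=; apply: eq_bigr => a _.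
by rewrite linearZ /= /partial deriveE.
Qed.

(** Only the outer function has to be differentiable in the strong sense. *)
Lemma is_derive_chain (V : normedModType R) m (f : 'rV[R]_m -> R)
    (phi : V -> 'rV[R]_m) (dphi : 'I_m -> R) x v :
  differentiable f (phi x) ->
  (forall a, is_derive x v (fun y => phi y 0 a) (dphi a)) ->
  is_derive x v (f \o phi) (\sum_(a < m) dphi a * partial a f (phi x)).
Proof.
move=> df dp; apply/is_derive_lineP.
pose gam (h : R) := phi (h *: v + x).
have gam0 : gam 0 = phi x by rewrite /gam scale0r add0r.
have dga a : is_derive (0 : R) (1 : R) (fun h => gam h 0 a) (dphi a).
  by have /is_derive_lineP := dp a.
have dg : derivable gam (0 : R) (1 : R).
  by apply/derivable_mxP => i j; rewrite (ord1 i); case: (dga j).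
have dfg : differentiable (f \o gam) (0 : R).
  apply: differentiable_comp; first exact/derivable1_diffP.
  by rewrite gam0.
apply: DeriveDef; first exact/derivable1_diffP.
rewrite deriveE// (diff_comp (f := gam))//=; last 2 first.
- exact/derivable1_diffP.
- by rewrite gam0.
rewrite gam0 diff_partial//; apply: eq_bigr => a _; congr (_ * _).
rewrite -deriveE; last exact/derivable1_diffP.
rewrite derive_mx// mxE; have [_ <-] := dga a; reflexivity.
Qed.

Lemma is_derive_fsum (V : normedModType R) (I : finType) (F : I -> V -> R)
    (dF : I -> R) x v :
  (forall i, is_derive x v (F i) (dF i)) ->
  is_derive x v (fun y => \sum_i F i y) (\sum_i dF i).
Proof.
move=> HF; elim: (index_enum I) => [|i s IH].
  rewrite big_nil (_ : (fun y => _) = cst 0); first exact: is_derive_cst.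
  by apply/funext => y; rewrite big_nil.
rewrite big_cons (_ : (fun y => _) = F i + (fun y => \sum_(j <- s) F j y)).
  exact: (is_deriveD (HF i) IH).
by apply/funext => y; rewrite big_cons.
Qed.

Lemma is_derive_prod (V : normedModType R) k (F : 'I_k -> V -> R) (dF : 'I_k -> R) x v :
  (forall a, is_derive x v (F a) (dF a)) ->
  is_derive x v (fun y => \prod_a F a y)
    (\sum_mu \prod_a if a == mu then dF a else F a x).
Proof.
elim: k F dF => [|k IH] F dF dFa.
  rewrite big_ord0 (_ : (fun y => _) = cst 1); first exact: is_derive_cst.
  by apply/funext => y; rewrite big_ord0.
have -> : (fun y => \prod_a F a y) =
    F ord0 * (fun y => \prod_(a < k) F (lift ord0 a) y).
  by apply/funext => y; rewrite big_ord_recl.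
have d2 := IH (fun a => F (lift ord0 a)) (fun a => dF (lift ord0 a)) (fun a => dFa _).
apply: (is_derive_eq (is_deriveM (dFa ord0) d2)).
rewrite big_ord_recl /= addrC; congr (_ + _).
  rewrite big_ord_recl /= /GRing.scale/= mulrC; congr (_ * _).
rewrite /GRing.scale/= mulr_sumr; apply: eq_bigr => i _.
by rewrite big_ord_recl /=.
Qed.
End ChainRule.

(** * Smooth functions on open subsets of Euclidean space *)

Section SmoothCalculus.
Variables (R : realType).
Local Notation rV n := 'rV[R]_n.

Lemma for_continuousD (T : topologicalType) (f g : T -> R) x :
  {for x, continuous f} -> {for x, continuous g} ->
  {for x, continuous (fun y => f y + g y)}.
Proof. by move=> cf cg; apply: (@cvgD _ R^o); [exact: cf|exact: cg]. Qed.

Lemma for_continuousM (T : topologicalType) (f g : T -> R) x :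
  {for x, continuous f} -> {for x, continuous g} ->
  {for x, continuous (fun y => f y * g y)}.
Proof. by move=> cf cg; apply: cvgM; [exact: cf|exact: cg]. Qed.

(** [k]-fold continuous differentiability.  The recursive form suits inductions
    through the product and chain rules, where the derivatives of a compound
    expression are again compound expressions. *)
Fixpoint Ck n k (U : set (rV n)) (f : rV n -> R) : Prop :=
  (forall x, U x -> {for x, continuous f}) /\
  if k is k'.+1 then forall i : 'I_n,
    (forall x, U x -> derivable f x (delta_mx 0 i)) /\ Ck k' U (partial i f)
  else True.

Lemma Ck_continuous n k (U : set (rV n)) f : Ck k U f ->
  forall x, U x -> {for x, continuous f}.
Proof. by case: k => [|k] []. Qed.

Lemma CkS_is_derive n k (U : set (rV n)) f i : Ck k.+1 U f ->
  forall x, U x -> is_derive x (delta_mx 0 i) f (partial i f x).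
Proof. by move=> [_ /(_ i)[H _]] x /H/derivableP. Qed.

Lemma CkS_partial n k (U : set (rV n)) f i : Ck k.+1 U f -> Ck k U (partial i f).
Proof. by move=> [_ /(_ i)[]]. Qed.

Lemma CkW n k (U : set (rV n)) f : Ck k.+1 U f -> Ck k U f.
Proof.
elim: k f => [|k IH] f [cf df]; split => // i; split; first by have [] := df i.
by apply: IH; have [] := df i.
Qed.

Lemma smooth_onP n (U : set (rV n)) f : smooth_on U f <-> forall k, Ck k U f.
Proof.
split=> [sf k|].
  elim: k f sf => [|k IH] f sf; split => //; try by move=> x /(sf [::])[].
  move=> i; split; first by move=> x /(sf [::])[].
  by apply: IH => s x /(sf (rcons s i)); rewrite foldr_rcons.
move=> Hf s; elim/last_ind: s f Hf => [|s i IH] f Hf.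
  move=> x Ux; split; first exact: (Ck_continuous (Hf 0%N)).
  by move=> i; have [_ /(_ i)[d _]] := Hf 1%N; exact: d.
rewrite foldr_rcons; apply: IH => k; exact: CkS_partial (Hf k.+1).
Qed.

Lemma smooth_on_subset n (U V : set (rV n)) f : V `<=` U ->
  smooth_on U f -> smooth_on V f.
Proof. by move=> VU sf s x /VU /sf. Qed.

Lemma smooth_on_setU n (U V : set (rV n)) f :
  smooth_on U f -> smooth_on V f -> smooth_on (U `|` V) f.
Proof. by move=> sU sV s x [/sU|/sV]. Qed.

Lemma smooth_on_continuous n (U : set (rV n)) f : smooth_on U f ->
  forall x, U x -> {for x, continuous f}.
Proof. by move=> sf x /(sf [::])[]. Qed.

Lemma smooth_on_is_derive n (U : set (rV n)) f i : smooth_on U f ->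
  forall x, U x -> is_derive x (delta_mx 0 i) f (partial i f x).
Proof. by move=> sf x /(sf [::])[_ /(_ i)] /derivableP. Qed.

Lemma smooth_on_partial n (U : set (rV n)) f i :
  smooth_on U f -> smooth_on U (partial i f).
Proof. by move=> sf s x /(sf (rcons s i)); rewrite foldr_rcons. Qed.

Lemma open_near n (U : set (rV n)) (P : rV n -> Prop) x : open U -> U x ->
  (forall y, U y -> P y) -> \near x, P x.
Proof. by move=> oU Ux UP; apply: filterS UP _; exact: open_nbhs_nbhs. Qed.

Lemma is_derive_open n (U : set (rV n)) (f g : rV n -> R) x v d :
  open U -> U x -> (forall y, U y -> f y = g y) ->
  is_derive x v f d -> is_derive x v g d.
Proof. by move=> oU Ux fg; apply: near_eq_is_derive; exact: (open_near oU Ux fg). Qed.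

Lemma continuous_open n (U : set (rV n)) (f g : rV n -> R) x : open U -> U x ->
  (forall y, U y -> f y = g y) -> {for x, continuous f} -> {for x, continuous g}.
Proof.
move=> oU Ux fg cf; rewrite /prop_for /continuous_at -(fg x Ux).
by apply: cvg_trans cf; exact: (near_eq_cvg (open_near oU Ux fg)).
Qed.

(** Functions expressed in a chart are meaningful on its image only, so
    differentiability must be insensitive to the values outside an open set. *)
Lemma eq_Ck n k (U : set (rV n)) f g : open U -> (forall y, U y -> f y = g y) ->
  Ck k U f -> Ck k U g.
Proof.
move=> oU; elim: k f g => [|k IH] f g fg Hf.
  by split=> // x Ux; exact: (continuous_open oU Ux fg (Ck_continuous Hf Ux)).
split; first by move=> x Ux; exact: (continuous_open oU Ux fg (Ck_continuous Hf Ux)).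
move=> i; split=> [x Ux|].
  by have [] := is_derive_open oU Ux fg (CkS_is_derive i Hf Ux).
apply: IH (CkS_partial i Hf) => x Ux.
by have [_] := is_derive_open oU Ux fg (CkS_is_derive i Hf Ux).
Qed.

Lemma eq_smooth_on n (U : set (rV n)) f g : open U ->
  (forall y, U y -> f y = g y) -> smooth_on U f -> smooth_on U g.
Proof. by move=> oU fg /smooth_onP Hf; apply/smooth_onP => k; exact: eq_Ck (Hf k). Qed.

Lemma CkS_intro n k (U : set (rV n)) f (df : 'I_n -> rV n -> R) : open U ->
  (forall x, U x -> {for x, continuous f}) ->
  (forall i x, U x -> is_derive x (delta_mx 0 i) f (df i x)) ->
  (forall i, Ck k U (df i)) -> Ck k.+1 U f.
Proof.
move=> oU cf dfE Hdf; split => // i; split=> [x /(dfE i)[]//|].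
by apply: eq_Ck (Hdf i) => // x /(dfE i)[].
Qed.

Lemma Ck_cst n k (U : set (rV n)) (a : R) : open U -> Ck k U (cst a).
Proof.
move=> oU; elim: k a => [|k IH] a; first by split=> // x _; exact: cst_continuous.
apply: (@CkS_intro _ _ _ _ (fun _ => cst 0)) => //.
by move=> x _; exact: cst_continuous.
Qed.

Lemma CkD n k (U : set (rV n)) f g : open U -> Ck k U f -> Ck k U g ->
  Ck k U (fun x => f x + g x).
Proof.
move=> oU; elim: k f g => [|k IH] f g Hf Hg.
  split=> // x Ux.
  exact: (for_continuousD (Ck_continuous Hf Ux) (Ck_continuous Hg Ux)).
apply: (@CkS_intro _ _ _ _ (fun i x => partial i f x + partial i g x)) => //.
- move=> x Ux.
  exact: (for_continuousD (Ck_continuous Hf Ux) (Ck_continuous Hg Ux)).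
- by move=> i x Ux; exact: (is_deriveD (CkS_is_derive i Hf Ux) (CkS_is_derive i Hg Ux)).
- by move=> i; apply: IH; exact: CkS_partial.
Qed.

Lemma CkM n k (U : set (rV n)) f g : open U -> Ck k U f -> Ck k U g ->
  Ck k U (fun x => f x * g x).
Proof.
move=> oU; elim: k f g => [|k IH] f g Hf Hg.
  split=> // x Ux.
  exact: (for_continuousM (Ck_continuous Hf Ux) (Ck_continuous Hg Ux)).
apply: (@CkS_intro _ _ _ _ (fun i x => f x * partial i g x + g x * partial i f x)) => //.
- move=> x Ux.
  exact: (for_continuousM (Ck_continuous Hf Ux) (Ck_continuous Hg Ux)).
- by move=> i x Ux; exact: (is_deriveM (CkS_is_derive i Hf Ux) (CkS_is_derive i Hg Ux)).
- move=> i; apply: CkD => //; apply: IH; by [exact: CkS_partial|exact: CkW].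
Qed.

(** With [r] for the inverse square root of [f], the derivatives of [r] are
    [- 2^-1 * r ^+ 3] times those of [f], so the induction on [k] closes up
    without the square root itself. *)
Lemma Ck_rsqrt n k (U : set (rV n)) f : open U -> (forall x, U x -> 0 < f x) ->
  Ck k U f -> Ck k U (fun x => (Num.sqrt (f x))^-1).
Proof.
move=> oU f0 Hf.
have cr x : U x -> {for x, continuous (fun x => (Num.sqrt (f x))^-1)}.
  move=> Ux; apply: (@continuousV _ _ (fun x => Num.sqrt (f x))).
    by rewrite gt_eqF// sqrtr_gt0 f0.
  apply: (@continuous_comp _ _ _ f Num.sqrt); first exact: (Ck_continuous Hf).
  exact: sqrt_continuous.
elim: k Hf => [|k IH] Hf; first by split.
apply: (@CkS_intro _ _ _ _ (fun i x => cst (- 2^-1) x * ((Num.sqrt (f x))^-1 *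
  ((Num.sqrt (f x))^-1 * ((Num.sqrt (f x))^-1 * partial i f x))))) => //.
- move=> i x Ux; have f0x := f0 _ Ux.
  have s0 : Num.sqrt (f x) != 0 by rewrite gt_eqF// sqrtr_gt0.
  have ds := is_deriveV s0 (is_derive1_sqrt f0x).
  apply: (is_derive_eq (is_derive_comp1 (CkS_is_derive i Hf Ux) ds)).
  by rewrite /GRing.scale/=; field.
- have Hr := IH (CkW Hf).
  move=> i; apply: CkM => //; first exact: Ck_cst.
  by do 3 (apply: CkM => //); exact: CkS_partial.
Qed.

Lemma Ck_differentiable n k (U : set (rV n)) f x : open U -> U x ->
  Ck k.+1 U f -> differentiable f x.
Proof.
move=> oU Ux Hf; apply: continuous_partials_differentiable.
  by apply: open_near oU Ux _ => y Uy i; have [] := CkS_is_derive i Hf Uy.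
by move=> i; exact: Ck_continuous (CkS_partial i Hf) _ Ux.
Qed.

Lemma Ck_sum n k (U : set (rV n)) (I : finType) (F : I -> rV n -> R) : open U ->
  (forall i, Ck k U (F i)) -> Ck k U (fun x => \sum_i F i x).
Proof.
move=> oU HF.
suff H (s : seq I) : Ck k U (fun x => \sum_(i <- s) F i x) by exact: H.
elim: s => [|i s IH].
  by apply: eq_Ck (Ck_cst _ 0 oU) => // x _; rewrite big_nil.
by apply: eq_Ck (CkD oU (HF i) IH) => // x _; rewrite big_cons.
Qed.

Lemma Ck_prod n k (U : set (rV n)) (I : finType) (F : I -> rV n -> R) : open U ->
  (forall i, Ck k U (F i)) -> Ck k U (fun x => \prod_i F i x).
Proof.
move=> oU HF.
suff H (s : seq I) : Ck k U (fun x => \prod_(i <- s) F i x) by exact: H.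
elim: s => [|i s IH].
  by apply: eq_Ck (Ck_cst _ 1 oU) => // x _; rewrite big_nil.
by apply: eq_Ck (CkM oU (HF i) IH) => // x _; rewrite big_cons.
Qed.

Lemma row_continuous n m (phi : rV n -> rV m) x :
  (forall a, {for x, continuous (fun y => phi y 0 a)}) -> {for x, continuous phi}.
Proof.
move=> cphi P [/= A nA AP].
have H : \forall y \near x, forall a, A 0 a (phi y 0 a).
  by apply: (filter_forall (nbhs_filter x)) => a; exact: cphi (nA 0 a).
have H' : \forall y \near x, P (phi y).
  by near=> y; apply: AP => i a; rewrite (ord1 i); move: a; near: y.
exact: H'.
Unshelve. all: by end_near. Qed.

(** By the chain rule the partial derivatives of [f \o phi] are sums of products
    of [partial a f \o phi] and of derivatives of [phi], to which the induction
    hypothesis applies. *)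
Lemma Ck_comp n m k (U : set (rV n)) (V : set (rV m)) f (phi : rV n -> rV m) :
  open U -> open V -> (forall x, U x -> V (phi x)) ->
  (forall a, Ck k U (fun x => phi x 0 a)) -> Ck k V f -> Ck k U (f \o phi).
Proof.
move=> oU oV UV Hphi Hf.
have cfphi x : U x -> {for x, continuous (f \o phi)}.
  move=> Ux; apply: continuous_comp; last exact: (Ck_continuous Hf) (UV _ Ux).
  by apply: row_continuous => a; exact: (Ck_continuous (Hphi a)).
elim: k f Hf Hphi cfphi => [|k IH] f Hf Hphi cfphi; first by split.
have cf' a x : U x -> {for x, continuous (partial a f \o phi)}.
  move=> Ux; apply: continuous_comp.
    by apply: row_continuous => b; exact: (Ck_continuous (Hphi b)).
  exact: (Ck_continuous (CkS_partial a Hf)) (UV _ Ux).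
apply: (@CkS_intro _ _ _ _ (fun i x => \sum_a (partial i (fun y => phi y 0 a) x *
  (partial a f \o phi) x))) => //.
  move=> i x Ux; apply: is_derive_chain.
    exact: Ck_differentiable oV (UV _ Ux) Hf.
  by move=> a; exact: (CkS_is_derive i (Hphi a)).
move=> i; apply: Ck_sum => // a; apply: CkM => //.
  exact: CkS_partial (Hphi a).
apply: IH; first exact: CkS_partial; last exact: cf'.
by move=> b; exact: CkW.
Qed.

Section SmoothClosure.
Variables (n : nat) (U : set (rV n)) (oU : open U).
Implicit Types f g : rV n -> R.

Lemma smooth_on_cst (a : R) : smooth_on U (cst a).
Proof. by apply/smooth_onP => k; exact: Ck_cst. Qed.

Lemma smooth_onD f g : smooth_on U f -> smooth_on U g ->
  smooth_on U (fun x => f x + g x).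
Proof.
by move=> /smooth_onP Hf /smooth_onP Hg; apply/smooth_onP => k; exact: CkD.
Qed.

Lemma smooth_onM f g : smooth_on U f -> smooth_on U g ->
  smooth_on U (fun x => f x * g x).
Proof.
by move=> /smooth_onP Hf /smooth_onP Hg; apply/smooth_onP => k; exact: CkM.
Qed.

Lemma smooth_on_rsqrt f : (forall x, U x -> 0 < f x) -> smooth_on U f ->
  smooth_on U (fun x => (Num.sqrt (f x))^-1).
Proof. by move=> f0 /smooth_onP Hf; apply/smooth_onP => k; exact: Ck_rsqrt. Qed.

Lemma smooth_on_sum (I : finType) (F : I -> rV n -> R) :
  (forall i, smooth_on U (F i)) -> smooth_on U (fun x => \sum_i F i x).
Proof.
by move=> HF; apply/smooth_onP => k; apply: Ck_sum => // i; have /smooth_onP := HF i.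
Qed.

Lemma smooth_on_prod (I : finType) (F : I -> rV n -> R) :
  (forall i, smooth_on U (F i)) -> smooth_on U (fun x => \prod_i F i x).
Proof.
by move=> HF; apply/smooth_onP => k; apply: Ck_prod => // i; have /smooth_onP := HF i.
Qed.

Lemma smooth_on_comp m (V : set (rV m)) (f : rV m -> R) (phi : rV n -> rV m) : open V ->
  (forall x, U x -> V (phi x)) ->
  (forall a, smooth_on U (fun x => phi x 0 a)) -> smooth_on V f ->
  smooth_on U (f \o phi).
Proof.
move=> oV UV Hphi /smooth_onP Hf; apply/smooth_onP => k.
by apply: Ck_comp UV _ (Hf k) => // a; have /smooth_onP := Hphi a.
Qed.

Lemma smooth_on_det m (A : rV n -> 'M[R]_m) :
  (forall i j, smooth_on U (fun x => A x i j)) -> smooth_on U (fun x => \det (A x)).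
Proof.
move=> HA; apply: smooth_on_sum => s; apply: smooth_onM; first exact: smooth_on_cst.
by apply: smooth_on_prod => i.
Qed.

Lemma smooth_on_differentiable f x : U x -> smooth_on U f -> differentiable f x.
Proof. by move=> Ux /smooth_onP /(_ 1%N); exact: Ck_differentiable. Qed.

Lemma smooth_on_partial_comm f i j x : U x -> smooth_on U f ->
  partial i (partial j f) x = partial j (partial i f) x.
Proof.
move=> Ux sf.
have [si sj] := (smooth_on_partial i sf, smooth_on_partial j sf).
apply: (@mixed_derive_eq _ _ f (partial j f) (partial i f)
  (partial i (partial j f)) (partial j (partial i f)) x (delta_mx 0 j) (delta_mx 0 i)).
- by apply: open_near oU Ux _ => y Uy; split;
    [exact: smooth_on_is_derive sf _ Uy|exact: smooth_on_is_derive sf _ Uy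
    |exact: smooth_on_is_derive sj _ Uy|exact: smooth_on_is_derive si _ Uy].
- exact: (smooth_on_continuous (smooth_on_partial i sj)).
- exact: (smooth_on_continuous (smooth_on_partial j si)).
Qed.
End SmoothClosure.
End SmoothCalculus.

(** * Tensors as arrays, determinants *)

Section TupleSums.
Variables (R : comNzRingType) (n : nat).

(** Distributivity: contracting product tensors over all their indices at once is
    contracting each factor separately. *)
Lemma sum_prod_tuple k (F : 'I_k -> 'I_n -> R) :
  \sum_(I : k.-tuple 'I_n) \prod_a F a (tnth I a) = \prod_a \sum_j F a j.
Proof.
rewrite bigA_distr_bigA /=.
rewrite (reindex (fun f : {ffun 'I_k -> 'I_n} => [tuple f a | a < k])) /=.
  by apply: eq_bigr => f _; apply: eq_bigr => a _; rewrite tnth_mktuple.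
exists (fun I : k.-tuple 'I_n => [ffun a => tnth I a]) => [f _|I _].
  by apply/ffunP => a; rewrite ffunE tnth_mktuple.
by apply: eq_from_tnth => a; rewrite tnth_mktuple ffunE.
Qed.

Lemma sum_cons_tuple k (F : k.+1.-tuple 'I_n -> R) :
  \sum_L F L = \sum_i \sum_(I : k.-tuple 'I_n) F [tuple of i :: I].
Proof.
rewrite pair_big /= (reindex (fun iI : 'I_n * k.-tuple 'I_n => [tuple of iI.1 :: iI.2])) /=.
  by apply: eq_bigr => -[i I] _.
exists (fun L => (thead L, [tuple of behead L])) => [[i I] _|L _] /=.
  by rewrite theadE; congr pair; exact: val_inj.
by rewrite -tuple_eta.
Qed.

Lemma sum_delta_tuple k (K : k.-tuple 'I_n) (F : k.-tuple 'I_n -> R) :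
  \sum_I (\prod_a (tnth I a == tnth K a)%:R) * F I = F K.
Proof.
rewrite (bigD1 K) //= big1 ?mul1r => [|a _]; last by rewrite eqxx.
rewrite big1 ?addr0 // => I IK.
have [a Ia] : exists a, tnth I a != tnth K a.
  apply/existsP; apply: contraR IK; rewrite negb_exists => /forallP E.
  by apply/eqP/eq_from_tnth => a; apply/eqP; rewrite -[_ == _]negbK E.
by rewrite (bigD1 a) //= (negbTE Ia) !mul0r.
Qed.

(** The transformation law of covariant tensors, [A] being the Jacobian matrix of
    the old coordinates with respect to the new ones. *)
Definition tpull k (A : 'M[R]_n) (t : k.-tuple 'I_n -> R) (J : k.-tuple 'I_n) : R :=
  \sum_(I : k.-tuple 'I_n) (\prod_(a < k) A (tnth I a) (tnth J a)) * t I.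

Definition tinner k (G : 'M[R]_n) (s t : k.-tuple 'I_n -> R) : R :=
  \sum_(I : k.-tuple 'I_n) \sum_(J : k.-tuple 'I_n)
    (\prod_(a < k) G (tnth I a) (tnth J a)) * s I * t J.

(** Contraction of the first two indices, in the order in which the formal adjoint
    of the covariant derivative presents them. *)
Definition tcontract k (G : 'M[R]_n) (t : k.+2.-tuple 'I_n -> R) (I : k.-tuple 'I_n) : R :=
  \sum_i \sum_j G i j * t [tuple of j :: i :: I].

Lemma conj_mxE (A G : 'M[R]_n) i j :
  (A *m G *m A^T) i j = \sum_l \sum_m A i l * G l m * A j m.
Proof.
rewrite mxE exchange_big /=; apply: eq_bigr => m _.
by rewrite !mxE mulr_suml; apply: eq_bigr => l _.
Qed.

(** Changing coordinates in both arguments amounts to changing [G] like an inverse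
    metric, so the pairing of two tensors is independent of the chart. *)
Lemma tinner_pull k (A G : 'M[R]_n) (s t : k.-tuple 'I_n -> R) :
  tinner G (tpull A s) (tpull A t) = tinner (A *m G *m A^T) s t.
Proof.
pose P (B : 'M[R]_n) (I J : k.-tuple 'I_n) := \prod_a B (tnth I a) (tnth J a).
have PE I J : P (A *m G *m A^T) I J = \sum_L \sum_M P A I L * P G L M * P A J M.
  under [RHS]eq_bigr do under eq_bigr do rewrite /P -!big_split /=.
  rewrite /P; under eq_bigr do rewrite conj_mxE.
  rewrite -(sum_prod_tuple (fun a l => \sum_m A (tnth I a) l * G l m * A (tnth J a) m)).
  apply: eq_bigr => L _.
  by rewrite -(sum_prod_tuple (fun a m =>
    A (tnth I a) (tnth L a) * G (tnth L a) m * A (tnth J a) m)).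
transitivity (\sum_I \sum_J \sum_L \sum_M
    P A I L * P G L M * P A J M * (s I * t J)).
  transitivity (\sum_L \sum_M \sum_I \sum_J P A I L * P G L M * P A J M * (s I * t J)).
    apply: eq_bigr => L _; apply: eq_bigr => M _; rewrite -/(P G L M) /tpull.
    rewrite -mulrA big_distrlr mulr_sumr; apply: eq_bigr => I _.
    rewrite mulr_sumr; apply: eq_bigr => J _.
    rewrite /= -/(P A I L) -/(P A J M); ring.
  under eq_bigr do rewrite exchange_big /=.
  rewrite exchange_big /=; apply: eq_bigr => I _.
  under eq_bigr do rewrite exchange_big /=.
  by rewrite exchange_big.
apply: eq_bigr => I _; apply: eq_bigr => J _.
rewrite -/(P _ I J) PE -mulrA mulr_suml; apply: eq_bigr => L _.
by rewrite mulr_suml.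
Qed.

Lemma prod_cons2 k (A : 'M[R]_n) i j (I : k.-tuple 'I_n) i' j' (I' : k.-tuple 'I_n) :
  \prod_a A (tnth [tuple of i :: j :: I] a) (tnth [tuple of i' :: j' :: I'] a) =
  A i i' * (A j j' * \prod_a A (tnth I a) (tnth I' a)).
Proof.
rewrite !big_ord_recl !tnth0; congr (_ * (_ * _)).
by apply: eq_bigr => a _; rewrite !tnthS.
Qed.

Lemma tcontract_pull k (A G : 'M[R]_n) (t : k.+2.-tuple 'I_n -> R) I :
  tcontract G (tpull A t) I = tpull A (tcontract (A *m G *m A^T) t) I.
Proof.
transitivity (\sum_i \sum_j \sum_l \sum_m \sum_(L : k.-tuple 'I_n)
   (\prod_a A (tnth L a) (tnth I a)) * (A m i * G i j * A l j * t [tuple of l :: m :: L])).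
  apply: eq_bigr => i _; apply: eq_bigr => j _.
  rewrite /tpull sum_cons_tuple mulr_sumr; apply: eq_bigr => l _.
  rewrite sum_cons_tuple mulr_sumr; apply: eq_bigr => m _.
  rewrite mulr_sumr; apply: eq_bigr => L _.
  rewrite prod_cons2; ring.
transitivity (\sum_(L : k.-tuple 'I_n) \sum_m \sum_l \sum_i \sum_j
   (\prod_a A (tnth L a) (tnth I a)) * (A m i * G i j * A l j * t [tuple of l :: m :: L])).
  under eq_bigr do under eq_bigr do under eq_bigr do rewrite exchange_big /=.
  under eq_bigr do under eq_bigr do rewrite exchange_big /=.
  under eq_bigr do rewrite exchange_big /=.
  rewrite exchange_big /=; apply: eq_bigr => L _.
  under eq_bigr do under eq_bigr do rewrite exchange_big /=.
  under eq_bigr do rewrite exchange_big /=.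
  rewrite exchange_big /=; apply: eq_bigr => m _.
  under eq_bigr do rewrite exchange_big /=.
  by rewrite exchange_big.
apply: eq_bigr => L _; rewrite mulr_sumr; apply: eq_bigr => m _.
rewrite mulr_sumr; apply: eq_bigr => l _.
rewrite conj_mxE mulr_suml mulr_sumr; apply: eq_bigr => i _.
by rewrite mulr_suml mulr_sumr.
Qed.
End TupleSums.

Section Determinants.

(** A positive definite matrix is joined to the identity by a segment of
    positive definite, hence invertible, matrices; along it the determinant is
    a polynomial without roots. *)
Lemma det_posdef (R : realType) n (A : 'M[R]_n) :
  (forall v : 'rV[R]_n, v != 0 -> 0 < \sum_i \sum_j A i j * v 0 i * v 0 j) ->
  0 < \det A.
Proof.
move=> pA.
have dn0 (t : R) : 0 <= t <= 1 -> \det (t%:M + (1 - t) *: A) != 0.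
  move=> /andP[t0 t1]; apply/negP => /det0P[v v0 vA].
  have E j : t * v 0 j + (1 - t) * \sum_i v 0 i * A i j = 0.
    have /matrixP /(_ 0 j) := vA.
    by rewrite mulmxDr mul_mx_scalar -scalemxAr !mxE.
  have : \sum_j v 0 j * (t * v 0 j + (1 - t) * \sum_i v 0 i * A i j) = 0.
    by apply: big1 => j _; rewrite E mulr0.
  rewrite (_ : \sum_j _ = t * \sum_j v 0 j ^+ 2 +
      (1 - t) * \sum_i \sum_j A i j * v 0 i * v 0 j).
    apply/eqP; rewrite gt_eqF//.
    have [t10|t10] := eqVneq t 1.
      rewrite t10 subrr mul0r addr0 mul1r lt_neqAle sumr_ge0 ?andbT//; last first.
        by move=> j _; exact: sqr_ge0.
      apply: contra v0; rewrite eq_sym psumr_eq0; last by move=> j _; exact: sqr_ge0.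
      move=> /allP H; apply/eqP/rowP => j; rewrite mxE.
      by apply/eqP; rewrite -sqrf_eq0; apply: H; rewrite mem_index_enum.
    rewrite ltr_wpDl// ?mulr_ge0 ?sumr_ge0// => [j _|]; first exact: sqr_ge0.
    by rewrite mulr_gt0 ?pA// subr_gt0 lt_neqAle t10.
  rewrite exchange_big !mulr_sumr -big_split /=; apply: eq_bigr => j _.
  rewrite mulrDr; congr (_ + _); first by ring.
  rewrite !mulr_sumr; apply: eq_bigr => i _; ring.
pose p : {poly R} := \det ('X%:M + (1 - 'X) *: map_mx polyC A).
have pE t : p.[t] = \det (t%:M + (1 - t) *: A).
  rewrite /p -horner_evalE -det_map_mx; congr (\det _).
  apply/matrixP => i j; rewrite !mxE /horner_eval.
  by rewrite /= /horner_eval !(hornerD, hornerM, hornerMn, hornerN, hornerX, hornerC).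
have -> : \det A = p.[0] by rewrite pE subr0 scale1r raddf0 add0r.
rewrite ltNge; apply/negP => p0.
have p1 : p.[1] = 1 by rewrite pE subrr scale0r addr0 det1.
have [|x x01 /rootP] := @poly_ivt R p 0 1 ler01.
  by rewrite p0 p1 ler01.
by move/eqP; rewrite pE; apply/negP/dn0.
Qed.

(** Jacobi's formula: differentiating the Leibniz expansion replaces one row [mu]
    of [A x] by that of [dA], and the resulting determinant is expanded along this
    row. *)
Lemma is_derive_det (R : realType) (V : normedModType R) n (A : V -> 'M[R]_n)
    (dA : 'M[R]_n) x v :
  (forall i j, is_derive x v (fun y => A y i j) (dA i j)) ->
  is_derive x v (fun y => \det (A y)) (\tr (\adj (A x) *m dA)).
Proof.
move=> dAx.
have D (s : 'S_n) : is_derive x v (fun y => (-1) ^+ s * \prod_i A y i (s i))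
    ((-1) ^+ s * \sum_mu \prod_i if i == mu then dA i (s i) else A x i (s i)).
  have Ds := is_derive_prod (fun i => dAx i (s i)).
  exact: (is_deriveZ ((-1) ^+ s) Ds).
have -> : \tr (\adj (A x) *m dA) = \sum_(s : 'S_n)
    ((-1) ^+ s * \sum_mu \prod_i if i == mu then dA i (s i) else A x i (s i)).
  rewrite mxtrace_mulC.
  under [RHS]eq_bigr do rewrite mulr_sumr.
  rewrite exchange_big /=; apply: eq_bigr => mu _.
  pose B : 'M[R]_n := \matrix_(i, j) if i == mu then dA i j else A x i j.
  transitivity (\det B).
    rewrite (expand_det_row B mu) mxE; apply: eq_bigr => j _.
    rewrite !mxE eqxx; congr (_ * (_ * \det _)).
    by apply/matrixP => a b; rewrite !mxE eq_sym (negbTE (neq_lift _ _)).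
  by apply: eq_bigr => s _; congr (_ * _); apply: eq_bigr => i _; rewrite mxE.
exact: (is_derive_fsum D).
Qed.
End Determinants.

(** * Integrals with respect to a density *)

Section Density.
Local Open Scope ereal_scope.
Context d1 d2 (X : measurableType d1) (Y : measurableType d2) (R : realType).
Variables (mu : {measure set X -> \bar R}) (nu : {measure set Y -> \bar R}).
Variables (E : set X) (D : set Y) (phi : X -> Y) (w : Y -> R).
Hypotheses (mE : measurable E) (mD : measurable D).
Hypotheses (mphi : measurable_fun E phi) (mw : measurable_fun D w).
Hypotheses (w0 : forall y, D y -> (0 <= w y)%R) (ED : forall x, E x -> D (phi x)).
Hypothesis mu_density : forall B, measurable B ->
  mu (E `&` phi @^-1` B) = \int[nu]_(y in D `&` B) (w y)%:E.

Import HBNNSimple.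

Let integral_density_indic B : measurable B ->
  \int[mu]_(x in E) (\1_B (phi x))%:E = \int[nu]_(y in D) (\1_B y * w y)%:E.
Proof.
move=> mB.
rewrite (_ : (fun x => (\1_B (phi x))%:E) = (fun x => (\1_(phi @^-1` B) x)%:E))//.
rewrite -[in LHS](setIid E) integral_mkcondr.
rewrite (eq_integral (fun x => (\1_(E `&` phi @^-1` B) x)%:E)); last first.
  move=> x xE; rewrite patchE !indicE in_setI xE/=.
  by rewrite (_ : (x \in phi @^-1` B) = (phi x \in B))//; apply/idP/idP; rewrite !inE.
rewrite integral_indic//; last exact: mphi.
rewrite setIAC setIid mu_density// integral_mkcondr.
apply: eq_integral => y _; rewrite patchE indicE; case: ifP => _; first by rewrite mul1r.
by rewrite mul0r.
Qed.

Let integral_density_nnsfun (g : {nnsfun Y >-> R}) :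
  \int[mu]_(x in E) (g (phi x))%:E = \int[nu]_(y in D) (g y * w y)%:E.
Proof.
under eq_integral do rewrite fimfunE -fsumEFin//.
rewrite ge0_integral_fsum//; last 2 first.
  - move=> r; apply/measurable_EFinP; apply: measurable_funM => //.
    exact: (measurableT_comp _ mphi).
  - by move=> r x _; rewrite EFinM nnfun_muleindic_ge0.
under [RHS]eq_integral.
  move=> y yD; rewrite fimfunE EFinM -fsumEFin// ge0_mule_fsuml; last first.
    by move=> r; rewrite EFinM nnfun_muleindic_ge0.
  over.
have mind r : measurable_fun D (fun y => (\1_(g @^-1` [set r]) y * w y)%R).
  by apply: measurable_funM => //; exact: measurable_funTS.
rewrite [RHS]ge0_integral_fsum//; last 2 first.
  - move=> r; rewrite (_ : (fun y => _) =
      (fun y => (r * (\1_(g @^-1` [set r]) y * w y))%:E)).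
      by apply/measurable_EFinP; apply: measurable_funM.
    by apply/funext => y; rewrite -EFinM mulrA.
  - move=> r y Dy; apply: mule_ge0; last by rewrite lee_fin w0.
    by rewrite EFinM nnfun_muleindic_ge0.
apply: eq_fsbigr => r /[!inE] -[y _ <-].
under eq_integral do rewrite EFinM.
rewrite ge0_integralZl_EFin//; last first.
  by apply/measurable_EFinP; exact: (measurableT_comp _ mphi).
rewrite integral_density_indic//.
under [RHS]eq_integral do rewrite -EFinM -mulrA EFinM.
rewrite ge0_integralZl_EFin//.
- by move=> z Dz; rewrite lee_fin mulr_ge0// w0.
- exact/measurable_EFinP.
Qed.

(** If the image under [phi] of [mu] restricted to [E] has density [w] with
    respect to [nu], then integrals over [E] are computed on [D]. *)
Lemma ge0_integral_density (f : Y -> \bar R) : measurable_fun D f ->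
  (forall y, D y -> 0 <= f y) ->
  \int[mu]_(x in E) f (phi x) = \int[nu]_(y in D) (f y * (w y)%:E).
Proof.
move=> mf f0.
pose f_ := nnsfun_approx mD mf.
transitivity (limn (fun n => \int[mu]_(x in E) (f_ n (phi x))%:E)).
  rewrite -monotone_convergence//.
  - apply: eq_integral => y /[!inE] yD; apply/esym/cvg_lim => //.
    by apply: cvg_nnsfun_approx => //; exact: ED.
  - by move=> n; apply/measurable_EFinP; exact: (measurableT_comp _ mphi).
  - by move=> n y _; rewrite lee_fin.
  - by move=> y _ m n mn; rewrite lee_fin; exact/lefP/nd_nnsfun_approx.
under eq_fun do rewrite integral_density_nnsfun.
rewrite -monotone_convergence//.
- apply: eq_integral => y /[!inE] yD; apply/cvg_lim => //.
  under eq_fun do rewrite EFinM.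
  by apply: cvgeZr => //; exact: cvg_nnsfun_approx.
- move=> n; apply/measurable_EFinP; apply: measurable_funM => //.
  exact: measurable_funTS.
- by move=> n y Dy; rewrite lee_fin mulr_ge0// w0.
- move=> y Dy m n mn; rewrite lee_fin ler_wpM2r ?w0//.
  exact/lefP/nd_nnsfun_approx.
Qed.

(** Positive and negative parts transform separately, so the identity holds with
    the convention for non integrable functions on both sides. *)
Lemma integral_density (f : Y -> R) : measurable_fun D f ->
  \int[mu]_(x in E) (f (phi x))%:E = \int[nu]_(y in D) (f y * w y)%:E.
Proof.
move=> mf; have mf' : measurable_fun D (EFin \o f) by exact/measurable_EFinP.
rewrite integralE [RHS]integralE.
have Ep : \int[mu]_(x in E) (fun x => (f (phi x))%:E)^\+ x =
    \int[nu]_(y in D) ((EFin \o f)^\+ y * (w y)%:E).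
  rewrite -ge0_integral_density//; last exact: measurable_funepos.
  by apply: eq_integral => x _; rewrite !funeposE.
have En : \int[mu]_(x in E) (fun x => (f (phi x))%:E)^\- x =
    \int[nu]_(y in D) ((EFin \o f)^\- y * (w y)%:E).
  rewrite -ge0_integral_density//; last exact: measurable_funeneg.
  by apply: eq_integral => x _; rewrite !funenegE.
rewrite Ep En; congr (_ - _); apply: eq_integral => y /[!inE] Dy.
- by rewrite !funeposE/= -!EFin_max -EFinM maxr_pMl ?w0// mul0r.
- by rewrite !funenegE/= -!EFin_max -EFinM maxr_pMl ?w0// mul0r mulNr.
Qed.
End Density.

(** * Borel sets and locally integrable functions *)

Section BorelFunctions.
Variable R : realType.

Lemma open_borel (T : ptopologicalType) (U : set T) : open U ->
  measurable (U : set (borel T)).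
Proof. by move=> oU; exact: sub_sigma_algebra. Qed.

Lemma compact_borel (T : ptopologicalType) (K : set T) : hausdorff_space T ->
  compact K -> measurable (K : set (borel T)).
Proof.
move=> hT cK; rewrite -[K]setCK; apply: measurableC; apply: open_borel.
by apply: closed_openC; exact: compact_closed.
Qed.

Lemma open_preimage (T S : topologicalType) (U : set T) (f : T -> S) (V : set S) :
  open U -> {in U, continuous f} -> open V -> open (U `&` f @^-1` V).
Proof.
move=> oU cf oV; rewrite openE => x [Ux Vx]; rewrite /interior.
apply: filterI; first exact: open_nbhs_nbhs.
by apply: (cf x); rewrite ?inE//; exact: open_nbhs_nbhs.
Qed.

Lemma continuous_borel (T S : ptopologicalType) (U : set T) (f : T -> S) :
  open U -> {in U, continuous f} ->
  measurable_fun (U : set (borel T)) (f : borel T -> borel S).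
Proof.
move=> oU cf; apply: (@measurability _ _ _ (borel S) _ _ (@open S)) => //.
by move=> _ [V oV <-]; apply: open_borel; exact: open_preimage.
Qed.

Lemma continuous_borelR (T : ptopologicalType) (U : set T) (f : T -> R) :
  open U -> {in U, continuous f} ->
  measurable_fun (U : set (borel T)) (f : borel T -> measurableTypeR R).
Proof.
move=> oU cf; apply: (measurability _ (RGenOpens.measurableE R)).
move=> _ [_ [a [b ->] <-]]; apply: open_borel; exact: open_preimage.
Qed.

Lemma compact_bounded_on (T : ptopologicalType) (K : set T) (f : T -> R) :
  compact K -> {in K, continuous f} ->
  exists C : R, 0 <= C /\ forall x, K x -> `|f x| <= C.
Proof.
move=> cK cf; have [->|/set0P K0] := eqVneq K set0; first by exists 0.
have cn : {within K, continuous (fun x => `|f x|)}.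
  apply: continuous_in_subspaceT => x Kx.
  by apply: (@continuous_comp _ _ _ f Num.norm); [exact: cf|exact: norm_continuous].
have [c _ Hc] := compact_EVT_max K0 cK cn.
by exists `|f c|; split => [|x Kx]; [exact: normr_ge0|apply: Hc; rewrite inE].
Qed.
End BorelFunctions.

Section LocallyIntegrable.
Variables (R : realType) (T : ptopologicalType).
Variable mu : {measure set (borel T) -> \bar R}.
Hypothesis hT : hausdorff_space T.
Variables (U : set T) (oU : open U).
Implicit Types f h : T -> R.

Lemma L1loc_on_compact f K : L1loc_on mu U f -> K `<=` U -> compact K ->
  mu.-integrable (K : set (borel T)) (EFin \o f).
Proof.
move=> [mf Hf] KU cK; apply/integrableP; split; last exact: Hf.
apply/measurable_EFinP; apply: measurable_funS mf => //; exact: open_borel oU.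
Qed.

(** A continuous factor is bounded on every compact set. *)
Lemma L1loc_onM f h : {in U, continuous h} -> L1loc_on mu U f ->
  L1loc_on mu U (fun x => h x * f x).
Proof.
move=> ch Lf; have [mf _] := Lf; split=> [|K KU cK].
  by apply: measurable_funM => //; exact: continuous_borelR.
have mK : measurable (K : set (borel T)) by exact: compact_borel.
have [C [C0 HC]] : exists C : R, 0 <= C /\ forall x, K x -> `|h x| <= C.
  by apply: compact_bounded_on => // x /[!inE] Kx; apply: ch; rewrite inE; exact: KU.
have iC : mu.-integrable (K : set (borel T)) (fun x => C%:E * (f x)%:E)%E.
  by apply: integrableZl => //; exact: L1loc_on_compact.
have /integrableP[_] := iC; apply: le_lt_trans.
apply: ge0_le_integral => //.
- apply/measurable_EFinP; apply: measurableT_comp => //; apply: measurable_funM.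
    apply: measurable_funS (continuous_borelR oU ch) => //; exact: open_borel.
  by apply: measurable_funS mf => //; exact: open_borel.
- by apply: measurableT_comp => //; case/integrableP: iC.
- move=> x Kx; rewrite -EFinM abse_EFin lee_fin !normrM (ger0_norm C0).
  by rewrite ler_wpM2r// HC.
Qed.

Lemma L1loc_onD f h : L1loc_on mu U f -> L1loc_on mu U h ->
  L1loc_on mu U (fun x => f x + h x).
Proof.
move=> Lf Lh; have [[mf _] [mh _]] := (Lf, Lh); split=> [|K KU cK].
  exact: measurable_funD.
have mK : measurable (K : set (borel T)) by exact: compact_borel.
have := integrableD mK (L1loc_on_compact Lf KU cK) (L1loc_on_compact Lh KU cK).
by move=> /integrableP[].
Qed.

Lemma L1loc_on_sum (I : finType) (f : I -> T -> R) :
  (forall i, L1loc_on mu U (f i)) -> L1loc_on mu U (fun x => \sum_i f i x).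
Proof.
move=> Lf; elim: (index_enum I) => [|i s IH].
  rewrite (_ : (fun x => _) = cst 0); last by apply/funext => x; rewrite big_nil.
  split=> [|K _ _]; first exact: measurable_cst.
  by under eq_integral do rewrite normr0; rewrite integral0.
rewrite (_ : (fun x => _) = (fun x => f i x + \sum_(j <- s) f j x)).
  exact: L1loc_onD.
by apply/funext => x; rewrite big_cons.
Qed.

(** The integral over [U] reduces to the integral over the compact set [K]. *)
Lemma L1loc_on_integrable f h K : L1loc_on mu U f -> {in U, continuous h} ->
  compact K -> K `<=` U -> (forall x, ~ K x -> h x = 0) ->
  mu.-integrable (U : set (borel T)) (fun x => (f x * h x)%:E).
Proof.
move=> Lf ch cK KU h0.
have mU : measurable (U : set (borel T)) by exact: open_borel.
have mK : measurable (K : set (borel T)) by exact: compact_borel.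
have [mfh _] := L1loc_onM ch Lf.
have iK := L1loc_on_compact (L1loc_onM ch Lf) KU cK.
apply/integrableP; split.
  apply/measurable_EFinP; apply: eq_measurable_fun mfh => x _.
  by rewrite mulrC.
have /integrableP[_] := iK; apply: le_lt_trans.
rewrite -[in leRHS](setIidr KU) [leRHS]integral_mkcondr.
rewrite le_eqVlt; apply/orP; left; apply/eqP/eq_integral => x _.
rewrite patchE; case: ifPn => [_|]; first by rewrite /= mulrC.
by rewrite notin_setE => /h0 ->; rewrite mulr0 abse0.
Qed.
End LocallyIntegrable.

(** * Christoffel symbols at a point *)

Section ConnectionAlgebra.
Variables (R : comNzRingType) (n : nat).

Lemma prod_if k (mu : 'I_k) (X Z : 'I_k -> R) :
  \prod_a (if a == mu then X a else Z a) = X mu * \prod_(a | a != mu) Z a.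
Proof.
rewrite (bigD1 mu) //= eqxx; congr (_ * _).
by apply: eq_bigr => a /negbTE ->.
Qed.

Lemma tnth_subst_index k (I : k.-tuple 'I_n) mu l a :
  tnth (subst_index I mu l) a = if a == mu then l else tnth I a.
Proof. by rewrite tnth_mktuple. Qed.

Lemma sum_subst_swap k (mu : 'I_k) (F : k.-tuple 'I_n -> 'I_n -> R) :
  \sum_I \sum_l F I l = \sum_I \sum_l F (subst_index I mu l) (tnth I mu).
Proof.
rewrite !pair_big /=.
pose h (x : k.-tuple 'I_n * 'I_n) := (subst_index x.1 mu x.2, tnth x.1 mu).
have hK : involutive h.
  move=> [I l]; rewrite /h /= tnth_subst_index eqxx; congr pair.
  apply: eq_from_tnth => a; rewrite !tnth_subst_index.
  by case: eqVneq => [->|].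
by rewrite (reindex_inj (inv_inj hK)).
Qed.

(** The first two sums are the derivative, in the new coordinates, of a tensor
    given by its old components: differentiating the Jacobian factors [A] yields
    the terms in the second derivatives [H] of the change of coordinates.  They
    cancel against the inhomogeneous part of the law of the Christoffel symbols,
    and what remains is tensorial. *)
Lemma covariant_derivative_pull k (A : 'M[R]_n) (H Gam Gam' : 'I_n -> 'I_n -> 'I_n -> R)
    (T : k.-tuple 'I_n -> R) (dT : 'I_n -> k.-tuple 'I_n -> R) i (J : k.-tuple 'I_n) :
  (forall d j, \sum_l A d l * Gam' l i j =
     \sum_b A b i * (\sum_c A c j * Gam d b c) + H d i j) ->
  (\sum_I (\sum_mu \prod_a if a == mu then H (tnth I a) i (tnth J a)
                                  else A (tnth I a) (tnth J a)) * T I +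
   \sum_I (\prod_a A (tnth I a) (tnth J a)) * \sum_b A b i * dT b I) -
  \sum_mu \sum_l Gam' l i (tnth J mu) * tpull A T (subst_index J mu l) =
  \sum_b A b i * tpull A (fun I => dT b I -
     \sum_mu \sum_l Gam l b (tnth I mu) * T (subst_index I mu l)) J.
Proof.
move=> GamE.
have E mu : \sum_l Gam' l i (tnth J mu) * tpull A T (subst_index J mu l) =
   \sum_I (\prod_a if a == mu then H (tnth I a) i (tnth J a)
                   else A (tnth I a) (tnth J a)) * T I +
   \sum_b A b i * \sum_I (\prod_a A (tnth I a) (tnth J a)) *
      \sum_l Gam l b (tnth I mu) * T (subst_index I mu l).
  transitivity (\sum_I (\sum_l A (tnth I mu) l * Gam' l i (tnth J mu)) *
      (\prod_(a | a != mu) A (tnth I a) (tnth J a)) * T I).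
    rewrite /tpull; under eq_bigr do rewrite mulr_sumr.
    rewrite exchange_big /=; apply: eq_bigr => I _.
    rewrite !mulr_suml; apply: eq_bigr => l _.
    under eq_bigr do rewrite tnth_subst_index.
    rewrite (eq_bigr (fun a => if a == mu then A (tnth I a) l else A (tnth I a) (tnth J a))).
      by rewrite prod_if; ring.
    by move=> a _; case: ifP.
  under eq_bigr do rewrite GamE [_ * \prod_(a | _) _]mulrDl mulrDl.
  rewrite big_split /= addrC; congr (_ + _).
    apply: eq_bigr => I _; congr (_ * _).
    by rewrite (prod_if mu (fun a => H (tnth I a) i (tnth J a))).
  transitivity (\sum_b A b i * \sum_I \sum_c A c (tnth J mu) * Gam (tnth I mu) b c *
      (\prod_(a | a != mu) A (tnth I a) (tnth J a)) * T I).
    under eq_bigr do rewrite !mulr_suml.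
    rewrite exchange_big /=; apply: eq_bigr => b _.
    rewrite mulr_sumr; apply: eq_bigr => I _.
    rewrite -!mulrA; congr (_ * _).
    by rewrite mulr_suml; apply: eq_bigr => c _; rewrite !mulrA.
  apply: eq_bigr => b _; congr (_ * _).
  rewrite (sum_subst_swap mu) /=; apply: eq_bigr => I _.
  rewrite mulr_sumr; apply: eq_bigr => l _.
  rewrite tnth_subst_index eqxx [in RHS](bigD1 mu) //=.
  rewrite (eq_bigr (fun a => A (tnth I a) (tnth J a))); first by ring.
  by move=> a /negbTE amu; rewrite tnth_subst_index amu.
under [X in _ - X]eq_bigr do rewrite E.
rewrite big_split /= opprD addrACA.
rewrite (_ : \sum_I (\sum_mu _) * T I = \sum_mu \sum_I (\prod_a
    if a == mu then H (tnth I a) i (tnth J a) else A (tnth I a) (tnth J a)) * T I);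
  last by rewrite exchange_big /=; apply: eq_bigr => I _; rewrite mulr_suml.
rewrite subrr add0r.
rewrite (_ : \sum_I _ * (\sum_b A b i * dT b I) =
    \sum_b A b i * \sum_I (\prod_a A (tnth I a) (tnth J a)) * dT b I); last first.
  under [RHS]eq_bigr do rewrite mulr_sumr.
  rewrite exchange_big /=; apply: eq_bigr => I _.
  by rewrite mulr_sumr; apply: eq_bigr => b _; rewrite mulrCA.
rewrite exchange_big -sumrB; apply: eq_bigr => b _ /=.
rewrite -mulr_sumr -mulrBr; congr (_ * _).
rewrite exchange_big -sumrB; apply: eq_bigr => I _ /=.
by rewrite -mulr_sumr -mulrBr.
Qed.
End ConnectionAlgebra.

Section ChristoffelAlgebra.
Variables (R : realFieldType) (n : nat).
Variables (gm : 'M[R]_n) (dg : 'I_n -> 'M[R]_n).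
Hypotheses (gmU : gm \in unitmx) (gmS : gm^T = gm) (dgS : forall k, (dg k)^T = dg k).

(** The Christoffel symbols of the first and of the second kind at a point where
    the metric is [gm] and its [k]-th partial derivative is [dg k]. *)
Definition christoffel1 i j k := 2^-1 * (dg i j k + dg j i k - dg k i j).
Definition christoffel2 l i j := \sum_m invmx gm l m * christoffel1 i j m.

Lemma invmx_sym i j : invmx gm i j = invmx gm j i.
Proof. by rewrite -[in LHS]gmS -trmx_inv mxE. Qed.

Lemma dg_sym k i j : dg k i j = dg k j i.
Proof. by rewrite -[in LHS]dgS mxE. Qed.

Lemma gm_sym i j : gm i j = gm j i.
Proof. by rewrite -[in LHS]gmS mxE. Qed.

Lemma sum_invmx_gm i j : \sum_m invmx gm i m * gm m j = (i == j)%:R.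
Proof. by have /matrixP /(_ i j) := mulVmx gmU; rewrite !mxE. Qed.

Lemma lower_christoffel2 i j k : \sum_l christoffel2 l i j * gm l k = christoffel1 i j k.
Proof.
transitivity (\sum_m (\sum_l invmx gm m l * gm l k) * christoffel1 i j m).
  under eq_bigr do rewrite mulr_suml.
  rewrite exchange_big /=; apply: eq_bigr => m _.
  rewrite mulr_suml; apply: eq_bigr => l _; rewrite invmx_sym; ring.
under eq_bigr do rewrite sum_invmx_gm.
rewrite (bigD1 k) //= eqxx mul1r big1 ?addr0 // => m mk.
by rewrite (negbTE mk) mul0r.
Qed.

(** In the sum of the two symbols of the first kind the derivatives of the metric
    other than [dg k] cancel: the Levi-Civita connection is metric. *)
Lemma christoffel2_metric k i j :
  dg k i j = \sum_l christoffel2 l k i * gm l j + \sum_l christoffel2 l k j * gm l i.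
Proof.
rewrite !lower_christoffel2 /christoffel1 (dg_sym k j i) (dg_sym i k j) (dg_sym j k i).
by field.
Qed.

(** By symmetry of the inverse metric two of the three derivatives of the metric
    cancel. *)
Lemma trace_christoffel2 i :
  \sum_l christoffel2 l l i = 2^-1 * \tr (invmx gm *m dg i).
Proof.
rewrite /christoffel2 /christoffel1.
have -> : \sum_l \sum_m invmx gm l m * (2^-1 * (dg l i m + dg i l m - dg m l i)) =
   2^-1 * (\sum_l \sum_m invmx gm l m * dg i l m +
   (\sum_l \sum_m invmx gm l m * dg l i m - \sum_l \sum_m invmx gm l m * dg m l i)).
  rewrite -sumrB -big_split /= mulr_sumr; apply: eq_bigr => l _.
  rewrite -sumrB -big_split /= mulr_sumr; apply: eq_bigr => m _; ring.
congr (_ * _); rewrite [X in _ - X]exchange_big /=.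
rewrite [X in _ + (_ - X)](eq_bigr (fun l => \sum_m invmx gm l m * dg l i m)).
  rewrite subrr addr0 /mxtrace; apply: eq_bigr => l _; rewrite mxE.
  by apply: eq_bigr => m _; rewrite dg_sym.
by move=> l _; apply: eq_bigr => m _; rewrite invmx_sym dg_sym.
Qed.
End ChristoffelAlgebra.

Section ChristoffelTransformation.
Variables (R : realFieldType) (n : nat).
Variables (gm gm' : 'M[R]_n) (dg dg' : 'I_n -> 'M[R]_n) (A : 'M[R]_n).
Variable H : 'I_n -> 'I_n -> 'I_n -> R.
Hypotheses (gmU : gm \in unitmx) (gmS : gm^T = gm) (dgS : forall k, (dg k)^T = dg k).
Hypothesis invE : A *m invmx gm' *m A^T = invmx gm.
Hypothesis HS : forall d i j, H d i j = H d j i.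
Hypothesis dgE : forall k i j, dg' k i j =
  \sum_a \sum_b (H a k i * A b j + A a i * H b k j) * gm a b +
  \sum_a \sum_b A a i * A b j * \sum_c A c k * dg c a b.

(** The hypothesis [dgE] is the derivative of the law [gm' = A^T *m gm *m A] of the
    metric.  In the combination defining the symbols the six terms with second
    derivatives [H] reduce to two equal ones, by symmetry of [H] in its lower
    indices. *)
Lemma christoffel1_pull i j k : christoffel1 dg' i j k =
  \sum_c A c k * (\sum_a \sum_b A a i * A b j * christoffel1 dg a b c +
                  \sum_a H a i j * gm a c).
Proof.
pose S (F : 'I_n -> 'I_n -> 'I_n -> R) := \sum_a \sum_b \sum_c F a b c.
have S132 F : S F = S (fun a b c => F a c b).
  by apply: eq_bigr => a _; rewrite exchange_big.
have S231 F : S F = S (fun a b c => F b c a).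
  by rewrite /S [RHS]exchange_big; apply: eq_bigr => x _; rewrite [RHS]exchange_big.
pose Hk (x y z : 'I_n) := \sum_a \sum_b H a x y * A b z * gm a b.
have dgE' x y z : dg' x y z = Hk x y z + Hk x z y +
    S (fun a b c => A a y * A b z * A c x * dg c a b).
  rewrite dgE; congr (_ + _).
    rewrite [Hk x z y]exchange_big -big_split; apply: eq_bigr => a _ /=.
    rewrite -big_split; apply: eq_bigr => b _ /=.
    rewrite (gm_sym gmS b a); ring.
  apply: eq_bigr => a _; apply: eq_bigr => b _; rewrite mulr_sumr.
  by apply: eq_bigr => c _; rewrite mulrA.
have HkS x y z : Hk x y z = Hk y x z.
  by apply: eq_bigr => a _; apply: eq_bigr => b _; rewrite HS.
have -> : \sum_c A c k * (\sum_a \sum_b A a i * A b j * christoffel1 dg a b c +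
    \sum_a H a i j * gm a c) =
  S (fun a b c => 2^-1 * (A a i * A b j * A c k * dg a b c) +
    2^-1 * (A a i * A b j * A c k * dg b a c) -
    2^-1 * (A a i * A b j * A c k * dg c a b)) + Hk i j k.
  under eq_bigr do rewrite mulrDr.
  rewrite big_split /=; congr (_ + _); last first.
    by rewrite /Hk exchange_big; apply: eq_bigr => c _ /=; rewrite mulr_sumr;
      apply: eq_bigr => a _; ring.
  rewrite /S; under eq_bigr do rewrite mulr_sumr.
  rewrite exchange_big; apply: eq_bigr => a _ /=.
  under eq_bigr do rewrite mulr_sumr.
  rewrite exchange_big; apply: eq_bigr => b _ /=; apply: eq_bigr => c _.
  rewrite /christoffel1; ring.
have SD F G : S (fun a b c => F a b c + G a b c) = S F + S G.
  rewrite /S -big_split /=; apply: eq_bigr => c _.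
  by rewrite -big_split /=; apply: eq_bigr => a _; rewrite -big_split.
have SN F : S (fun a b c => - F a b c) = - S F.
  by rewrite /S -!sumrN; apply: eq_bigr => a _; rewrite -sumrN;
    apply: eq_bigr => b _; rewrite -sumrN.
have SZ x F : S (fun a b c => x * F a b c) = x * S F.
  by rewrite /S mulr_sumr; apply: eq_bigr => a _; rewrite mulr_sumr;
    apply: eq_bigr => b _; rewrite mulr_sumr.
rewrite !SD SN !SZ /christoffel1 !dgE'.
rewrite (HkS j i k) (HkS k i j) (HkS j k i) (HkS k j i).
rewrite [S (fun a b c => A a j * A b k * A c i * dg c a b)]S231.
rewrite [S (fun a b c => A a i * A b k * A c j * dg c a b)]S132.
have e1 : S (fun a b c => A b j * A c k * A a i * dg a b c) =
    S (fun a b c => A a i * A b j * A c k * dg a b c).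
  by apply: eq_bigr => a _; apply: eq_bigr => b _; apply: eq_bigr => c _; ring.
have e2 : S (fun a b c => A a i * A c k * A b j * dg b a c) =
    S (fun a b c => A a i * A b j * A c k * dg b a c).
  by apply: eq_bigr => a _; apply: eq_bigr => b _; apply: eq_bigr => c _; ring.
by rewrite e1 e2; field.
Qed.

Lemma christoffel2_pull d i j : \sum_l A d l * christoffel2 gm' dg' l i j =
  \sum_b A b i * (\sum_c A c j * christoffel2 gm dg d b c) + H d i j.
Proof.
pose X c := \sum_a \sum_b A a i * A b j * christoffel1 dg a b c + \sum_a H a i j * gm a c.
transitivity (\sum_c invmx gm d c * X c).
  transitivity (\sum_l \sum_m \sum_c A d l * invmx gm' l m * A c m * X c).
    apply: eq_bigr => l _; rewrite mulr_sumr; apply: eq_bigr => m _.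
    rewrite christoffel1_pull mulrA mulr_sumr; apply: eq_bigr => c _.
    by rewrite mulrA.
  under eq_bigr do rewrite exchange_big /=.
  rewrite exchange_big /=; apply: eq_bigr => c _.
  rewrite -invE conj_mxE mulr_suml; apply: eq_bigr => l _.
  by rewrite mulr_suml.
under eq_bigr do rewrite mulrDr.
rewrite big_split /=; congr (_ + _).
  transitivity (\sum_a \sum_b \sum_c A a i * A b j * (invmx gm d c * christoffel1 dg a b c)).
    under eq_bigr do rewrite mulr_sumr.
    rewrite exchange_big /=; apply: eq_bigr => a _.
    under eq_bigr do rewrite mulr_sumr.
    rewrite exchange_big /=; apply: eq_bigr => b _; apply: eq_bigr => c _; ring.
  apply: eq_bigr => a _; rewrite mulr_sumr; apply: eq_bigr => b _.
  by rewrite -mulr_sumr mulrA.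
transitivity (\sum_a H a i j * (\sum_c invmx gm d c * gm c a)).
  under eq_bigr do rewrite mulr_sumr.
  rewrite exchange_big /=; apply: eq_bigr => a _; rewrite mulr_sumr.
  apply: eq_bigr => c _; rewrite (gm_sym gmS a c); ring.
under eq_bigr do rewrite sum_invmx_gm//.
rewrite (bigD1 d) //= eqxx mulr1 big1 ?addr0 // => a /negbTE ad.
by rewrite eq_sym ad mulr0.
Qed.
End ChristoffelTransformation.

(** * Calculus in charts *)

Section ChartCalculus.
Variables (R : realType) (n : nat) (M : smooth_manifold R n).
Local Notation chart := (chart R n M).
Implicit Types (c : chart) (p : M) (f : M -> R) (W : set M).

Lemma chart_imageE c W :
  cmap c @` (W `&` cdom c) = cimg c `&` cinv c @^-1` W.
Proof.
apply/seteqP; split=> [_ [p [Wp cp] <-]|_ [[p cp <-] /=]].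
  by split; [exists p|rewrite /= cmapK].
by rewrite cmapK// => Wp; exists p.
Qed.

Lemma chart_image_open c W : open W -> open (cmap c @` (W `&` cdom c)).
Proof.
move=> oW; rewrite chart_imageE.
by apply: open_preimage (cinv_continuous (c := c)) oW; exact: cimg_open.
Qed.

Lemma cinvK c x : cimg c x -> cmap c (cinv c x) = x.
Proof. by move=> [p cp <-]; rewrite cmapK. Qed.

Lemma cinv_cdom c x : cimg c x -> cdom c (cinv c x).
Proof. by move=> [p cp <-]; rewrite cmapK. Qed.

Lemma pderiv_is_derive c i W f p : smooth_in_chart c W f -> W p -> cdom c p ->
  is_derive (cmap c p) (delta_mx 0 i) (f \o cinv c) (pderiv c i f p).
Proof. by move=> sf Wp cp; apply: smooth_on_is_derive sf _ _; exists p. Qed.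

Lemma smooth_in_chart_pderiv c i W f : open W -> smooth_in_chart c W f ->
  smooth_in_chart c W (pderiv c i f).
Proof.
move=> oW sf; apply: eq_smooth_on (smooth_on_partial i sf).
  exact: chart_image_open.
by move=> _ [p [_ cp] <-]; rewrite /= /pderiv cmapK.
Qed.

Lemma eq_pderiv c i W f h p : open W -> W p -> cdom c p ->
  (forall q, W q -> cdom c q -> f q = h q) -> pderiv c i f p = pderiv c i h p.
Proof.
move=> oW Wp cp fh; apply: near_eq_derive.
apply: (open_near (chart_image_open (c := c) oW)); first by exists p.
by move=> _ [q [Wq cq] <-]; rewrite /= cmapK// fh.
Qed.

Lemma pderiv_coord c a b p : cdom c p -> pderiv c b (Defs.coord c a) p = (a == b)%:R.
Proof.
move=> cp; rewrite /pderiv.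
transitivity (partial b (fun x : 'rV[R]_n => x 0 a) (cmap c p)).
  apply: near_eq_derive; apply: (open_near (cimg_open (c := c))); first by exists p.
  by move=> _ [q cq <-]; rewrite /= /Defs.coord cmapK.
have /matrixP /(_ 0 a) := derive_mx (@derivable_id _ _ (cmap c p) (delta_mx 0 b : 'rV[R]_n)).
by rewrite derive_id !mxE eqxx /= /partial => <-.
Qed.

Section Transition.
Variables (c c' : chart) (ac : atlas c) (ac' : atlas c').
Local Notation U := (cmap c' @` (cdom c `&` cdom c')).
Local Notation phi := (cmap c \o cinv c').

Lemma transition_open : open U.
Proof. by apply: chart_image_open; exact: cdom_open. Qed.

Lemma coord_smooth a : smooth_in_chart c' (cdom c) (Defs.coord c a).
Proof. exact: atlas_compat. Qed.

Lemma smooth_in_chart_transition W f : open W -> smooth_in_chart c W f ->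
  smooth_in_chart c' (W `&` cdom c) f.
Proof.
move=> oW sf.
have oU' : open (cmap c' @` ((W `&` cdom c) `&` cdom c')).
  by apply: chart_image_open; apply: openI => //; exact: cdom_open.
apply: (@eq_smooth_on _ _ _ ((f \o cinv c) \o phi)) => //.
  by move=> _ [q [[_ cq] cq'] <-] /=; rewrite !cmapK.
apply: (smooth_on_comp oU' (chart_image_open (c := c) oW)) sf.
  by move=> _ [q [[Wq cq] cq'] <-] /=; rewrite cmapK//; exists q.
move=> a; apply: smooth_on_subset (coord_smooth a).
by move=> _ [q [[_ cq] cq'] <-]; exists q.
Qed.

(** The chain rule for the transition map from [c'] to [c]. *)
Lemma pderiv_transition W f p b : open W -> smooth_in_chart c W f ->
  W p -> cdom c p -> cdom c' p ->
  pderiv c' b f p = \sum_a jacobian_mx c c' p a b * pderiv c a f p.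
Proof.
move=> oW sf Wp cp cp'.
have oU' : open (cmap c' @` ((W `&` cdom c) `&` cdom c')).
  by apply: chart_image_open; apply: openI => //; exact: cdom_open.
have Up : (cmap c' @` ((W `&` cdom c) `&` cdom c')) (cmap c' p) by exists p.
have D : is_derive (cmap c' p) (delta_mx 0 b) ((f \o cinv c) \o phi)
    (\sum_a pderiv c' b (Defs.coord c a) p * partial a (f \o cinv c) (phi (cmap c' p))).
  apply: is_derive_chain.
    rewrite /= cmapK//; apply: (smooth_on_differentiable (chart_image_open (c := c) oW)) sf.
    by exists p.
  by move=> a; exact: (pderiv_is_derive b (coord_smooth a)).
have [|_ E] := is_derive_open oU' Up _ D (g := f \o cinv c').
  by move=> _ [q [[_ cq] cq'] <-] /=; rewrite !cmapK.
rewrite {1}/pderiv /partial E; apply: eq_bigr => a _.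
by rewrite /= cmapK// !mxE.
Qed.

Lemma jacobian_smooth a b : smooth_in_chart c' (cdom c) (fun q => jacobian_mx c c' q a b).
Proof.
have -> : (fun q => jacobian_mx c c' q a b) = pderiv c' b (Defs.coord c a).
  by apply/funext => q; rewrite mxE.
by apply: smooth_in_chart_pderiv (coord_smooth a); exact: cdom_open.
Qed.

(** Both sides are second derivatives of a component of the transition map. *)
Lemma pderiv_jacobianC a i j p : cdom c p -> cdom c' p ->
  pderiv c' i (fun q => jacobian_mx c c' q a j) p =
  pderiv c' j (fun q => jacobian_mx c c' q a i) p.
Proof.
move=> cp cp'; have Up : U (cmap c' p) by exists p.
have E k l : pderiv c' k (fun q => jacobian_mx c c' q a l) p =
    partial k (partial l (Defs.coord c a \o cinv c')) (cmap c' p).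
  apply: near_eq_derive; apply: (open_near transition_open Up).
  by move=> _ [q [_ cq] <-]; rewrite /= mxE /pderiv cmapK.
rewrite !E; exact: (smooth_on_partial_comm transition_open i j Up (coord_smooth a)).
Qed.
End Transition.

Lemma jacobian_comp c1 c2 c3 p : atlas c1 -> atlas c2 -> atlas c3 ->
  cdom c1 p -> cdom c2 p -> cdom c3 p ->
  jacobian_mx c1 c3 p = jacobian_mx c1 c2 p *m jacobian_mx c2 c3 p.
Proof.
move=> a1 a2 a3 p1 p2 p3; apply/matrixP => a b; rewrite !mxE.
rewrite (pderiv_transition a2 a3 b (cdom_open c1) (coord_smooth a1 a2 a))//.
by apply: eq_bigr => k _; rewrite !mxE mulrC.
Qed.

Lemma jacobian_id c p : cdom c p -> jacobian_mx c c p = 1%:M.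
Proof. by move=> cp; apply/matrixP => a b; rewrite !mxE pderiv_coord. Qed.

Lemma jacobianK c c' p : atlas c -> atlas c' -> cdom c p -> cdom c' p ->
  jacobian_mx c c' p *m jacobian_mx c' c p = 1%:M.
Proof. by move=> ac ac' cp cp'; rewrite -jacobian_comp// jacobian_id. Qed.
End ChartCalculus.

(** * Tensor fields and the Levi-Civita connection *)

Section TensorCalculus.
Variables (R : realType) (n : nat) (M : smooth_manifold R n).
Variable g : riemannian_metric M.
Local Notation chart := (chart R n M).
Implicit Types (c : chart) (p : M).

Lemma sum_tuple2 (F : 2.-tuple 'I_n -> R) : \sum_I F I = \sum_i \sum_j F [tuple i; j].
Proof.
rewrite sum_cons_tuple; apply: eq_bigr => i _; rewrite sum_cons_tuple.
apply: eq_bigr => j _; rewrite (big_pred1 [tuple]); last by move=> I; apply/esym/eqP; exact: tuple0.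
by congr F; exact: val_inj.
Qed.

Lemma tensor_tpull k (T : components M k) c c' p J : is_tensor T ->
  atlas c -> atlas c' -> cdom c p -> cdom c' p ->
  T c' J p = tpull (jacobian_mx c c' p) (fun I => T c I p) J.
Proof. by move=> tT ac ac' cp cp'; exact: tT. Qed.

Lemma metric_pull c c' p i j : atlas c -> atlas c' -> cdom c p -> cdom c' p ->
  metric g c' [tuple i; j] p = \sum_a \sum_b
    jacobian_mx c c' p a i * jacobian_mx c c' p b j * metric g c [tuple a; b] p.
Proof.
move=> ac ac' cp cp'; have [tg _] := metric_smooth g.
rewrite (tg c c' p ac ac' cp cp') sum_tuple2.
apply: eq_bigr => a _; apply: eq_bigr => b _; congr (_ * _).
by rewrite !big_ord_recl big_ord0 mulr1.
Qed.

Lemma metric_mx_sym c p : atlas c -> cdom c p -> (metric_mx g c p)^T = metric_mx g c p.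
Proof. by move=> ac cp; apply/matrixP => i j; rewrite !mxE Defs.metric_sym. Qed.

Lemma det_metric_gt0 c p : atlas c -> cdom c p -> 0 < \det (metric_mx g c p).
Proof.
move=> ac cp; apply: det_posdef => v v0.
have := metric_pos g ac cp v0; congr (_ < _).
by apply: eq_bigr => i _; apply: eq_bigr => j _; rewrite mxE.
Qed.

Lemma metric_mx_unit c p : atlas c -> cdom c p -> metric_mx g c p \in unitmx.
Proof. by move=> ac cp; rewrite unitmxE unitfE gt_eqF// det_metric_gt0. Qed.

(** The inverse metric is contravariant. *)
Lemma inv_metric_pull c c' p : atlas c -> atlas c' -> cdom c p -> cdom c' p ->
  jacobian_mx c c' p *m inv_metric g c' p *m (jacobian_mx c c' p)^T = inv_metric g c p.
Proof.
move=> ac ac' cp cp'; rewrite /inv_metric.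
set A := jacobian_mx c c' p; set B := jacobian_mx c' c p.
have AB : A *m B = 1%:M by exact: jacobianK.
have -> : metric_mx g c' p = A^T *m metric_mx g c p *m A.
  rewrite -[X in _ = _ *m X]trmxK; apply/matrixP => i j.
  rewrite conj_mxE mxE (metric_pull _ _ ac)//.
  apply: eq_bigr => a _; apply: eq_bigr => b _.
  by rewrite -/A [A^T i a]mxE [A^T j b]mxE [metric_mx _ _ _ _ _]mxE mulrAC.
set X := A^T *m _ *m A.
have uX : X \in unitmx.
  have [uA _] := mulmx1_unit AB.
  by rewrite !unitmx_mul unitmx_tr uA metric_mx_unit.
apply: (can_inj (mulmxK (metric_mx_unit ac cp))); rewrite mulVmx ?metric_mx_unit//.
have E : A^T *m metric_mx g c p = X *m B by rewrite -mulmxA AB mulmx1.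
by rewrite -[LHS]mulmxA E mulmxA -[A *m _ *m _]mulmxA mulVmx// mulmx1.
Qed.

Definition metric_pderiv c p k : 'M[R]_n :=
  \matrix_(i, j) pderiv c k (metric g c [tuple i; j]) p.

Lemma metric_pderiv_sym c p k : atlas c -> cdom c p ->
  (metric_pderiv c p k)^T = metric_pderiv c p k.
Proof.
move=> ac cp; apply/matrixP => i j; rewrite !mxE.
by apply: (eq_pderiv k (cdom_open c)) => // q cq _; exact: Defs.metric_sym.
Qed.

Lemma christoffelE c l i j p :
  christoffel g c l i j p = christoffel2 (metric_mx g c p) (metric_pderiv c p) l i j.
Proof.
rewrite /christoffel /christoffel2 mulr_sumr; apply: eq_bigr => m _.
by rewrite /christoffel1 !mxE mulrCA.
Qed.

Lemma metric_in_chart c I : atlas c -> smooth_in_chart c (cdom c) (metric g c I).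
Proof. by have [_] := metric_smooth g; exact. Qed.

Section Transition.
Variables (c c' : chart) (p : M).
Hypotheses (ac : atlas c) (ac' : atlas c') (cp : cdom c p) (cp' : cdom c' p).
Local Notation A q := (jacobian_mx c c' q).
Local Notation H d i j := (pderiv c' i (fun q => jacobian_mx c c' q d j) p).
Local Notation U := (cmap c' @` (cdom c `&` cdom c')).
Let Up : U (cmap c' p). Proof. by exists p. Qed.

Lemma jacobian_is_derive a i b :
  is_derive (cmap c' p) (delta_mx 0 i) ((fun q => A q a b) \o cinv c') (H a i b).
Proof. by apply: pderiv_is_derive (jacobian_smooth ac ac' a b) _ _. Qed.

Lemma pderiv_is_derive_transition f i : smooth_in_chart c (cdom c) f ->
  is_derive (cmap c' p) (delta_mx 0 i) (f \o cinv c')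
    (\sum_b A p b i * pderiv c b f p).
Proof.
move=> sf; rewrite -(pderiv_transition ac ac' i (cdom_open c) sf)//.
apply: pderiv_is_derive (smooth_in_chart_transition ac ac' (cdom_open c) sf) _ _ => //.
Qed.

Lemma metric_pderiv_pull k i j : metric_pderiv c' p k i j =
  \sum_a \sum_b (H a k i * A p b j + A p a i * H b k j) * metric_mx g c p a b +
  \sum_a \sum_b A p a i * A p b j * \sum_d A p d k * metric_pderiv c p d a b.
Proof.
have D a b : is_derive (cmap c' p) (delta_mx 0 k)
    ((fun q => A q a i * A q b j * metric g c [tuple a; b] q) \o cinv c')
    ((H a k i * A p b j + A p a i * H b k j) * metric_mx g c p a b +
     A p a i * A p b j * \sum_d A p d k * metric_pderiv c p d a b).
  have D1 := is_deriveM (jacobian_is_derive a k i) (jacobian_is_derive b k j).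
  have D2 := is_deriveM D1 (pderiv_is_derive_transition k (metric_in_chart [tuple a; b] ac)).
  apply: (is_derive_eq D2); rewrite /GRing.scale/= cmapK// [metric_mx _ _ _ _ _]mxE.
  under [in RHS]eq_bigr do rewrite [metric_pderiv _ _ _ _ _]mxE.
  rewrite fctE/= cmapK//; ring.
have DS := is_derive_fsum (fun a => is_derive_fsum (D a)).
have [|_ E] := is_derive_open (@transition_open _ _ _ c c') Up
   (g := metric g c' [tuple i; j] \o cinv c') _ DS.
  by move=> _ [q [cq cq'] <-] /=; rewrite cmapK// (metric_pull _ _ ac).
rewrite mxE /pderiv /partial E -big_split /=; apply: eq_bigr => a _.
by rewrite -big_split.
Qed.

Lemma christoffel_pull d i j : \sum_l A p d l * christoffel g c' l i j p =
  \sum_b A p b i * (\sum_e A p e j * christoffel g c d b e p) + H d i j.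
Proof.
under eq_bigr do rewrite christoffelE.
under [in RHS]eq_bigr do under eq_bigr do rewrite christoffelE.
apply: (christoffel2_pull (H := fun d i j => H d i j)).
- exact: metric_mx_unit.
- exact: metric_mx_sym.
- exact: inv_metric_pull.
- by move=> a k l; exact: pderiv_jacobianC.
- exact: metric_pderiv_pull.
Qed.

Lemma nabla_pull k (T : components M k) i (J : k.-tuple 'I_n) : smooth_tensor T ->
  nabla g T c' [tuple of i :: J] p = \sum_b A p b i *
    tpull (A p) (fun I => nabla g T c [tuple of b :: I] p) J.
Proof.
move=> [tT sT].
have nablaE e (L : k.-tuple 'I_n) b : nabla g T e [tuple of b :: L] p =
    pderiv e b (T e L) p - \sum_mu \sum_l christoffel g e l b (tnth L mu) p *
      T e (subst_index L mu l) p.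
  rewrite /nabla theadE; set L' := [tuple of behead _].
  by have -> : L' = L by exact: val_inj.
rewrite nablaE.
have DI (I : k.-tuple 'I_n) : is_derive (cmap c' p) (delta_mx 0 i)
    ((fun q => (\prod_a A q (tnth I a) (tnth J a)) * T c I q) \o cinv c')
    ((\sum_mu \prod_a if a == mu then H (tnth I a) i (tnth J a)
                     else A p (tnth I a) (tnth J a)) * T c I p +
     (\prod_a A p (tnth I a) (tnth J a)) * \sum_b A p b i * pderiv c b (T c I) p).
  have D1 := is_derive_prod (fun a => jacobian_is_derive (tnth I a) i (tnth J a)).
  have D2 := is_deriveM D1 (pderiv_is_derive_transition i (sT c I ac)).
  apply: (is_derive_eq D2); rewrite /GRing.scale/= cmapK//.
  by rewrite addrC mulrC.
have DS := is_derive_fsum DI.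
have [|_ E] := is_derive_open (@transition_open _ _ _ c c') Up
   (g := T c' J \o cinv c') _ DS.
  by move=> _ [q [cq cq'] <-] /=; rewrite cmapK// (tensor_tpull J tT ac ac').
rewrite {1}/pderiv /partial E big_split /=.
under [X in _ - X]eq_bigr do under eq_bigr do rewrite (tensor_tpull _ tT ac ac')//.
have C := @covariant_derivative_pull _ _ _ (A p) (fun d i j => H d i j)
  (fun l i j => christoffel g c l i j p) (fun l i j => christoffel g c' l i j p)
  (fun I => T c I p)
  (fun b I => pderiv c b (T c I) p) i J (christoffel_pull ^~ i).
apply: etrans; first exact: C.
apply: eq_bigr => b _; congr (_ * _); apply: eq_bigr => I _; congr (_ * _).
by rewrite nablaE.
Qed.
End Transition.

Lemma nabla_tensor k (T : components M k) : smooth_tensor T -> is_tensor (nabla g T).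
Proof.
move=> sT c c' p ac ac' cp cp' L; rewrite [L]tuple_eta.
rewrite (nabla_pull ac ac')// sum_cons_tuple; apply: eq_bigr => b _.
rewrite mulr_sumr; apply: eq_bigr => I _.
rewrite big_ord_recl !tnth0 -mulrA; congr (_ * (_ * _)).
by apply: eq_bigr => a _; rewrite !tnthS.
Qed.

Lemma nabla_star_tensor k (T : components M k.+1) :
  smooth_tensor T -> is_tensor (nabla_star g T).
Proof.
move=> sT c c' p ac ac' cp cp' I.
have E e (L : k.-tuple 'I_n) : nabla_star g T e L p =
    - tcontract (inv_metric g e p) (fun J => nabla g T e J p) L by [].
rewrite E.
have -> : (fun J => nabla g T c' J p) =
    tpull (jacobian_mx c c' p) (fun J => nabla g T c J p).
  by apply/funext => J; apply: tensor_tpull => //; exact: nabla_tensor.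
rewrite tcontract_pull inv_metric_pull// -sumrN; apply: eq_bigr => J _.
by rewrite E mulrN.
Qed.

(** [tensor_inner] is computed in a chart picked at each point; for tensors any
    chart around the point gives the same value. *)
Lemma tensor_inner_chart k (S T : components M k) c p : is_tensor S -> is_tensor T ->
  atlas c -> cdom c p ->
  tensor_inner g S T p = tinner (inv_metric g c p) (fun I => S c I p) (fun I => T c I p).
Proof.
move=> tS tT ac cp; rewrite /tensor_inner; set c' := chart_at p.
have [ac' cp'] : atlas c' /\ cdom c' p.
  by rewrite /c' /chart_at; case: cid2.
transitivity (tinner (inv_metric g c' p) (fun I => S c' I p) (fun I => T c' I p)) => //.
rewrite -(inv_metric_pull ac ac' cp cp') -tinner_pull.
by congr tinner; apply/funext => I; apply: tensor_tpull.
Qed.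
End TensorCalculus.

(** * The Riemannian volume in a chart *)

Section ChartMeasure.
Variables (R : realType) (n : nat) (M : smooth_manifold R n).
Variables (g : riemannian_metric M) (Vol : {measure set (borel M) -> \bar R}).
Hypothesis volE : riemannian_volume g Vol.
Variables (c : chart R n M) (ac : atlas c).
Local Notation leb := (@lebesgue_rV R n).

Definition vol_density (x : 'rV[R]_n) : R :=
  Num.sqrt (\det (metric_mx g c (cinv c x))).

Lemma vol_density_gt0 x : cimg c x -> 0 < vol_density x.
Proof. by move=> /cinv_cdom cx; rewrite sqrtr_gt0 det_metric_gt0. Qed.

Lemma smooth_in_chart_cimg f :
  smooth_in_chart c (cdom c) f <-> smooth_on (cimg c) (f \o cinv c).
Proof. by rewrite /smooth_in_chart setIid. Qed.

Lemma det_metric_smooth : smooth_on (cimg c) (fun x => \det (metric_mx g c (cinv c x))).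
Proof.
apply: (smooth_on_det (cimg_open (c := c))) => i j.
under eq_fun do rewrite mxE.
by apply/smooth_in_chart_cimg; exact: metric_in_chart.
Qed.

Lemma inv_vol_density_smooth : smooth_on (cimg c) (fun x => (vol_density x)^-1).
Proof.
apply: smooth_on_rsqrt det_metric_smooth; first exact: cimg_open.
by move=> x /cinv_cdom cx; exact: det_metric_gt0.
Qed.

Lemma vol_density_continuous : {in cimg c, continuous vol_density}.
Proof.
move=> x /[!inE] cx; apply: (@continuous_comp _ _ _
  (fun x => \det (metric_mx g c (cinv c x))) Num.sqrt).
  exact: smooth_on_continuous det_metric_smooth _ cx.
exact: sqrt_continuous.
Qed.

Lemma cmap_borel :
  measurable_fun (cdom c : set (borel M)) (cmap c : borel M -> borel 'rV[R]_n).
Proof. by apply: continuous_borel; [exact: cdom_open|exact: cmap_continuous]. Qed.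

Lemma cinv_borel :
  measurable_fun (cimg c : set (borel 'rV[R]_n)) (cinv c : borel 'rV[R]_n -> borel M).
Proof. by apply: continuous_borel; [exact: cimg_open|exact: cinv_continuous]. Qed.

Lemma cimg_borel : measurable (cimg c : set (borel 'rV[R]_n)).
Proof. by apply: open_borel; exact: cimg_open. Qed.

Lemma cdom_borel : measurable (cdom c : set (borel M)).
Proof. by apply: open_borel; exact: cdom_open. Qed.

(** The Riemannian volume, read in the chart, has density [vol_density] with
    respect to the Lebesgue measure. *)
Lemma integral_chart (D : set (borel 'rV[R]_n)) (f : borel 'rV[R]_n -> R) :
  measurable D -> D `<=` cimg c -> measurable_fun D f ->
  (\int[Vol]_(p in cdom c `&` cmap c @^-1` D) (f (cmap c p))%:E =
   \int[leb]_(x in D) (f x * vol_density x)%:E)%E.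
Proof.
move=> mD Dc mf.
apply: (@integral_density _ _ (borel M) (borel 'rV[R]_n) R Vol leb
  (cdom c `&` cmap c @^-1` D) D (cmap c) vol_density) => //.
- exact: cmap_borel cdom_borel _ mD.
- apply: measurable_funS cmap_borel => //; exact: cdom_borel.
- apply: measurable_funS (continuous_borelR (cimg_open (c := c)) vol_density_continuous) => //.
  exact: cimg_borel.
- by move=> x /Dc /vol_density_gt0 /ltW.
- by move=> x [].
- move=> B mB; rewrite -setIA -preimage_setI volE//; last exact: measurableI.
  by rewrite (setIidr (subset_trans (@subIsetl _ _ _) Dc)).
Qed.

(** On a compact set the density is bounded away from [0]: dividing by it keeps
    [F] locally integrable, and undoes the density in the change of variables. *)
Lemma L1loc_chart (F : M -> R) : L1loc_on Vol (cdom c) F ->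
  L1loc_on leb (cimg c) (F \o cinv c).
Proof.
move=> LF; have [mF _] := LF.
have mFc : measurable_fun (cimg c : set (borel 'rV[R]_n))
    (F \o cinv c : borel 'rV[R]_n -> R).
  apply: measurable_comp mF cinv_borel; first exact: cdom_borel.
  by move=> _ [x cx <-]; exact: cinv_cdom.
split=> // K Kc cK.
have mK : measurable (K : set (borel 'rV[R]_n)).
  by apply: compact_borel cK; exact: norm_hausdorff.
pose h p := (vol_density (cmap c p))^-1.
have ch : {in cdom c, continuous h}.
  move=> p /[!inE] cp; apply: (@continuous_comp _ _ _ (cmap c) (fun x => (vol_density x)^-1)).
    by apply: cmap_continuous; rewrite inE.
  by apply: smooth_on_continuous inv_vol_density_smooth _ _; exists p.
have [_ LhF] := L1loc_onM (carrier_hausdorff (s := M)) (cdom_open c) ch LF.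
have cKM : compact (cinv c @` K).
  apply: continuous_compact cK; apply: continuous_in_subspaceT => x /[!inE] Kx.
  by apply: cinv_continuous; rewrite inE; exact: Kc.
have KE : cinv c @` K = cdom c `&` cmap c @^-1` K.
  apply/seteqP; split=> [_ [x Kx <-]|p [cp Kp]].
    by have cx := Kc _ Kx; split; [exact: cinv_cdom|rewrite /= cinvK].
  by exists (cmap c p) => //; rewrite cmapK.
have Kd : cinv c @` K `<=` cdom c by rewrite KE; exact: subIsetl.
have := LhF _ Kd cKM; rewrite KE.
have -> : (\int[Vol]_(p in cdom c `&` cmap c @^-1` K) `|h p * F p|%:E =
    \int[Vol]_(p in cdom c `&` cmap c @^-1` K)
      (`|(vol_density (cmap c p))^-1 * (F \o cinv c) (cmap c p)|)%:E)%E.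
  by apply: eq_integral => p /[!inE] -[cp _]; rewrite /= cmapK.
rewrite (@integral_chart K (fun x => `|(vol_density x)^-1 * (F \o cinv c) x|))//.
  congr (_ < _)%E; apply: eq_integral => x /[!inE] /Kc cx.
  have w0 := vol_density_gt0 cx.
  by rewrite normrM gtr0_norm ?invr_gt0// mulrAC mulVf ?gt_eqF// mul1r.
apply: measurableT_comp => //; apply: measurable_funM; last first.
  by apply: measurable_funS mFc => //; exact: cimg_borel.
have ciw : {in cimg c, continuous (fun x => (vol_density x)^-1)}.
  by move=> x /[!inE] cx; exact: smooth_on_continuous inv_vol_density_smooth _ cx.
apply: measurable_funS (continuous_borelR (cimg_open (c := c)) ciw) => //.
exact: cimg_borel.
Qed.
End ChartMeasure.

(** * The test tensor at a point *)

Section TestTensorAlgebra.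
Variables (R : realFieldType) (n : nat).
Variables (gm : 'M[R]_n) (dg : 'I_n -> 'M[R]_n).
Hypotheses (gmU : gm \in unitmx) (gmS : gm^T = gm) (dgS : forall k, (dg k)^T = dg k).
Local Notation Gam := (christoffel2 gm dg).
Local Notation G := (invmx gm).

(** The components of the decomposable tensor obtained by lowering the indices of
    the contravariant tensor whose only nonzero component is [1] at [K]. *)
Definition lowered k (K J : k.-tuple 'I_n) : R := \prod_a gm (tnth J a) (tnth K a).

Lemma behead_cons_tuple (T : Type) k (x : T) (s : k.-tuple T) :
  [tuple of behead [tuple of x :: s]] = s.
Proof. exact: val_inj. Qed.

(** A Kronecker symbol with one free slot leaves the sum over this slot. *)
Lemma sum_delta_but k (K : k.-tuple 'I_n) mu (F : k.-tuple 'I_n -> R) :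
  \sum_L (\prod_a if a == mu then 1 else (tnth L a == tnth K a)%:R) * F L =
  \sum_l F (subst_index K mu l).
Proof.
transitivity (\sum_L \sum_l (\prod_a (tnth L a == tnth (subst_index K mu l) a)%:R) * F L).
  apply: eq_bigr => L _; rewrite -mulr_suml; congr (_ * _).
  rewrite (prod_if mu (fun=> 1)) mul1r.
  rewrite [in RHS](bigD1 (tnth L mu)) //= [X in _ = X + _](bigD1 mu) //=.
  rewrite tnth_subst_index !eqxx mul1r.
  rewrite [X in _ = _ + X]big1 ?addr0 => [|l lL].
    by apply: eq_bigr => a /negbTE amu; rewrite tnth_subst_index amu.
  by rewrite (bigD1 mu) //= tnth_subst_index eqxx eq_sym (negbTE lL) mul0r.
by rewrite exchange_big /=; apply: eq_bigr => l _; rewrite sum_delta_tuple.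
Qed.

(** As the connection is metric, differentiating the lowered indices of
    [lowered K] amounts to differentiating its upper indices [K]. *)
Lemma covariant_derivative_lowered k (K J : k.-tuple 'I_n) j (h dh : R) :
  (lowered K J * dh + h * \sum_mu \prod_a if a == mu then dg j (tnth J a) (tnth K a)
                                      else gm (tnth J a) (tnth K a)) -
  \sum_mu \sum_l Gam l j (tnth J mu) * (lowered K (subst_index J mu l) * h) =
  lowered K J * dh + h * \sum_mu \prod_a
    if a == mu then \sum_l Gam l j (tnth K a) * gm l (tnth J a)
    else gm (tnth J a) (tnth K a).
Proof.
rewrite -addrA; congr (_ + _); rewrite !mulr_sumr -sumrB; apply: eq_bigr => mu _.
rewrite (prod_if mu (fun a => dg j (tnth J a) (tnth K a))).
rewrite (prod_if mu (fun a => \sum_l Gam l j (tnth K a) * gm l (tnth J a))).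
rewrite (christoffel2_metric gmU gmS dgS) mulrDl mulrDr.
rewrite [X in X + _ - _ = _](_ : _ = \sum_l Gam l j (tnth J mu) *
    (lowered K (subst_index J mu l) * h)); first by rewrite addrAC subrr add0r.
rewrite mulr_suml mulr_sumr; apply: eq_bigr => l _; rewrite /lowered.
rewrite [in RHS](eq_bigr (fun a => if a == mu then gm l (tnth K a)
    else gm (tnth J a) (tnth K a))).
  by rewrite prod_if; ring.
by move=> a _; rewrite tnth_subst_index; case: ifP.
Qed.

Lemma raise_lowered k (K L : k.-tuple 'I_n) :
  \sum_J (\prod_a G (tnth L a) (tnth J a)) * lowered K J =
  \prod_a (tnth L a == tnth K a)%:R.
Proof.
transitivity (\sum_J \prod_a (G (tnth L a) (tnth J a) * gm (tnth J a) (tnth K a))).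
  by apply: eq_bigr => J _; rewrite big_split.
rewrite (sum_prod_tuple (fun a m => G (tnth L a) m * gm m (tnth K a))).
by apply: eq_bigr => a _; rewrite sum_invmx_gm.
Qed.

(** Raising all indices turns every factor except the differentiated one into a
    Kronecker symbol. *)
Lemma raise_derivative_lowered k (K L : k.-tuple 'I_n) mu j :
  \sum_J (\prod_a G (tnth L a) (tnth J a)) *
    (\prod_a if a == mu then \sum_l Gam l j (tnth K a) * gm l (tnth J a)
             else gm (tnth J a) (tnth K a)) =
  (\prod_a if a == mu then 1 else (tnth L a == tnth K a)%:R) *
  Gam (tnth L mu) j (tnth K mu).
Proof.
transitivity (\sum_J \prod_a (G (tnth L a) (tnth J a) * (if a == mu then
    \sum_l Gam l j (tnth K a) * gm l (tnth J a) else gm (tnth J a) (tnth K a)))).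
  by apply: eq_bigr => J _; rewrite big_split.
rewrite (sum_prod_tuple (fun a m => G (tnth L a) m * (if a == mu then
  \sum_l Gam l j (tnth K a) * gm l m else gm m (tnth K a)))).
rewrite (eq_bigr (fun a => if a == mu then Gam (tnth L mu) j (tnth K mu)
    else (tnth L a == tnth K a)%:R)).
  by rewrite !prod_if mul1r mulrC.
move=> a _; case: eqVneq => [->|amu]; last by rewrite sum_invmx_gm.
transitivity (\sum_l Gam l j (tnth K mu) * (\sum_m G (tnth L mu) m * gm m l)).
  under eq_bigr do rewrite mulr_sumr.
  rewrite exchange_big /=; apply: eq_bigr => l _.
  rewrite mulr_sumr; apply: eq_bigr => m _; rewrite (gm_sym gmS m l); ring.
under eq_bigr do rewrite sum_invmx_gm//.
rewrite (bigD1 (tnth L mu)) //= eqxx mulr1 big1 ?addr0 // => l /negbTE lL.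
by rewrite eq_sym lL mulr0.
Qed.

Lemma tinner_lowered k (K : k.-tuple 'I_n) (t : k.-tuple 'I_n -> R) (h : R) :
  tinner G t (fun J => lowered K J * h) = t K * h.
Proof.
transitivity (\sum_L (\prod_a (tnth L a == tnth K a)%:R) * (t L * h)).
  apply: eq_bigr => L _; rewrite -raise_lowered mulr_suml.
  by apply: eq_bigr => J _; ring.
by rewrite sum_delta_tuple.
Qed.

Lemma subst_index_cons0 k i (I : k.-tuple 'I_n) l :
  subst_index [tuple of i :: I] ord0 l = [tuple of l :: I].
Proof.
apply: eq_from_tnth => a; rewrite tnth_subst_index.
by case: (unliftP ord0 a) => [b|] ->; rewrite ?tnthS ?tnth0 ?eqxx.
Qed.

Lemma subst_index_consS k i (I : k.-tuple 'I_n) mu l :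
  subst_index [tuple of i :: I] (lift ord0 mu) l = [tuple of i :: subst_index I mu l].
Proof.
apply: eq_from_tnth => a; rewrite tnth_subst_index.
case: (unliftP ord0 a) => [b|] ->; last by rewrite !tnth0.
by rewrite !tnthS tnth_subst_index (inj_eq lift_inj).
Qed.

(** The array [D] is the covariant derivative of the tensor field with the single
    contravariant component [h] at position [i :: I].  In its divergence the slot
    [i] contributes the trace of the Christoffel symbols, and the slots of [I]
    contribute the correction terms of the covariant derivative of [t]. *)
Lemma tinner_divergence k i (I : k.-tuple 'I_n) (t : k.-tuple 'I_n -> R) (h : R)
    (dh : 'I_n -> R) (D : k.+2.-tuple 'I_n -> R) :
  (forall j (J : k.+1.-tuple 'I_n), D [tuple of j :: J] =
     lowered [tuple of i :: I] J * dh j + h * \sum_mu \prod_a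
       if a == mu then \sum_l Gam l j (tnth [tuple of i :: I] a) * gm l (tnth J a)
       else gm (tnth J a) (tnth [tuple of i :: I] a)) ->
  tinner G t (tcontract G D) =
  t I * (dh i + h * \sum_l Gam l l i) +
  h * \sum_(mu < k) \sum_l Gam l i (tnth I mu) * t (subst_index I mu l).
Proof.
move=> DE; set K := [tuple of i :: I] in DE *.
pose F mu (L : k.+1.-tuple 'I_n) := t [tuple of behead L] * Gam (tnth L mu) (thead L) (tnth K mu).
have FE mu j (L : k.-tuple 'I_n) : F mu [tuple of j :: L] =
    t L * Gam (tnth [tuple of j :: L] mu) j (tnth K mu).
  by rewrite /F theadE behead_cons_tuple.
transitivity (\sum_(L : k.+1.-tuple 'I_n) (t [tuple of behead L] *
    (\sum_J (\prod_a G (tnth L a) (tnth J a)) * D [tuple of thead L :: J]))).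
  rewrite sum_cons_tuple exchange_big /=; apply: eq_bigr => L _.
  transitivity (\sum_j \sum_l \sum_J (\prod_a G (tnth L a) (tnth J a)) * t L *
       (G l j * D [tuple of j :: l :: J])).
    rewrite exchange_big /=; under [RHS]eq_bigr do rewrite exchange_big /=.
    rewrite [RHS]exchange_big /=; apply: eq_bigr => J _.
    rewrite /tcontract mulr_sumr; apply: eq_bigr => l _.
    by rewrite mulr_sumr.
  apply: eq_bigr => j _; rewrite behead_cons_tuple.
  rewrite sum_cons_tuple mulr_sumr; apply: eq_bigr => l _.
  rewrite mulr_sumr; apply: eq_bigr => J _.
  rewrite big_ord_recl !tnth0 [in RHS](eq_bigr (fun a => G (tnth L a) (tnth J a))); last first.
    by move=> a _; rewrite !tnthS.
  rewrite (invmx_sym gmS j l) theadE; ring.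
transitivity (\sum_(L : k.+1.-tuple 'I_n) ((\prod_a (tnth L a == tnth K a)%:R) *
     (t [tuple of behead L] * dh (thead L)) +
   h * \sum_mu (\prod_a if a == mu then 1 else (tnth L a == tnth K a)%:R) * F mu L)).
  apply: eq_bigr => L _; under [X in _ * X = _]eq_bigr do rewrite DE mulrDr.
  rewrite big_split /= mulrDr; congr (_ + _).
    rewrite -raise_lowered mulr_suml mulr_sumr; apply: eq_bigr => J _; ring.
  rewrite !mulr_sumr.
  transitivity (\sum_mu t [tuple of behead L] * h *
     \sum_J (\prod_a G (tnth L a) (tnth J a)) *
      (\prod_a if a == mu then \sum_l Gam l (thead L) (tnth K a) * gm l (tnth J a)
             else gm (tnth J a) (tnth K a))).
    under [RHS]eq_bigr do rewrite mulr_sumr.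
    rewrite exchange_big /=; apply: eq_bigr => J _.
    rewrite !mulr_sumr; apply: eq_bigr => mu _; ring.
  apply: eq_bigr => mu _; rewrite raise_derivative_lowered /F; ring.
rewrite big_split /= sum_delta_tuple -mulr_sumr [X in _ + _ * X = _]exchange_big /=.
under [X in _ + _ * X = _]eq_bigr do rewrite sum_delta_but.
rewrite big_ord_recl /= mulrDr addrA; congr (_ + _).
  rewrite theadE behead_cons_tuple.
  rewrite mulrDr; congr (_ + _).
  rewrite mulrCA; congr (_ * _); rewrite mulr_sumr; apply: eq_bigr => l _.
  by rewrite subst_index_cons0 FE !tnth0.
congr (_ * _); apply: eq_bigr => mu _; apply: eq_bigr => l _.
by rewrite subst_index_consS FE !tnthS tnth_subst_index eqxx mulrC.
Qed.
End TestTensorAlgebra.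

(** * The test tensor field *)

Section TestTensor.
Variables (R : realType) (n : nat) (M : smooth_manifold R n).
Variable g : riemannian_metric M.
Variables (c : chart R n M) (ac : atlas c).
Variables (psi : 'rV[R]_n -> R) (S : set 'rV[R]_n).
Hypotheses (spsi : smooth_on setT psi) (cS : compact S) (Sc : S `<=` cimg c).
Hypothesis psi0 : forall x, ~ S x -> psi x = 0.
Variables (k : nat) (K : k.-tuple 'I_n).
Implicit Types p : M.

(** The division by the density makes up for the weight of the Riemannian volume
    with respect to the Lebesgue measure. *)
Definition test_scalar p : R := psi (cmap c p) / vol_density g c (cmap c p).

(** The tensor field that in the chart [c] has the components [lowered K] times
    [test_scalar], hence after raising indices the single component [K].  In the
    other charts the definition is dictated by the transformation law, which for
    a decomposable tensor applies factor by factor. *)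
Definition test_tensor : components M k := fun c' J p =>
  if p \in cdom c then
    (\prod_a \sum_m jacobian_mx c c' p m (tnth J a) * metric g c [tuple m; tnth K a] p) *
    test_scalar p
  else 0.

Lemma test_tensorE c' J p : cdom c p -> test_tensor c' J p =
  (\prod_a \sum_m jacobian_mx c c' p m (tnth J a) * metric g c [tuple m; tnth K a] p) *
  test_scalar p.
Proof. by move=> cp; rewrite /test_tensor mem_set. Qed.

Lemma test_tensor_chart J p : cdom c p ->
  test_tensor c J p = lowered (metric_mx g c p) K J * test_scalar p.
Proof.
move=> cp; rewrite test_tensorE// jacobian_id//; congr (_ * _); apply: eq_bigr => a _.
rewrite (bigD1 (tnth J a)) //= !mxE eqxx mul1r big1 ?addr0 // => m /negbTE mJ.
by rewrite mxE mJ mul0r.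
Qed.

Definition test_support : set M := cinv c @` S.

Lemma compact_test_support : compact test_support.
Proof.
apply: continuous_compact cS; apply: continuous_in_subspaceT => x /[!inE] Sx.
by apply: cinv_continuous; rewrite inE; exact: Sc.
Qed.

Lemma open_test_supportC : open (~` test_support).
Proof.
apply: closed_openC; apply: compact_closed compact_test_support.
exact: carrier_hausdorff.
Qed.

Lemma test_tensor0 c' J p : ~ test_support p -> test_tensor c' J p = 0.
Proof.
move=> Sp; rewrite /test_tensor; case: ifPn => // /set_mem cp.
rewrite /test_scalar psi0 ?mul0r ?mulr0// => Scp.
by apply: Sp; exists (cmap c p) => //; rewrite cmapK.
Qed.

Lemma test_tensor_is_tensor : is_tensor test_tensor.
Proof.
move=> c1 c2 p a1 a2 p1 p2 J.
have [cp|ncp] := pselect (cdom c p); last first.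
  rewrite {1}/test_tensor memNset// big1// => I _.
  by rewrite /test_tensor memNset// mulr0.
rewrite test_tensorE//; under [RHS]eq_bigr do rewrite test_tensorE// mulrA -big_split.
rewrite -mulr_suml; congr (_ * _).
rewrite (sum_prod_tuple (fun a j => jacobian_mx c1 c2 p j (tnth J a) *
  \sum_m jacobian_mx c c1 p m j * metric g c [tuple m; tnth K a] p)).
apply: eq_bigr => a _; rewrite (jacobian_comp ac a1 a2)//.
under [RHS]eq_bigr do rewrite mulr_sumr.
rewrite exchange_big /=; apply: eq_bigr => m _.
rewrite mxE mulr_suml; apply: eq_bigr => j _; ring.
Qed.

Lemma test_scalar_smooth : smooth_in_chart c (cdom c) test_scalar.
Proof.
apply/smooth_in_chart_cimg.
apply: (@eq_smooth_on _ _ _ (fun x => psi x * (vol_density g c x)^-1)).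
- exact: cimg_open.
- by move=> x cx; rewrite /= /test_scalar cinvK.
apply: smooth_onM; first exact: cimg_open.
  by apply: smooth_on_subset spsi.
exact: inv_vol_density_smooth.
Qed.

(** The manifold is covered by two open sets: the domain of [c], where the
    components are products of smooth functions, and the complement of the
    compact support, where they vanish. *)
Lemma test_tensor_smooth : smooth_tensor test_tensor.
Proof.
split; first exact: test_tensor_is_tensor.
move=> c' J ac'; rewrite /smooth_in_chart.
pose U1 := cmap c' @` (cdom c `&` cdom c').
pose U2 := cmap c' @` (~` test_support `&` cdom c').
apply: (@smooth_on_subset _ _ (U1 `|` U2)).
  move=> _ [p [_ cp'] <-].
  have [cp|ncp] := pselect (cdom c p); first by left; exists p.
  right; exists p => //; split => // -[x Sx xp]; apply: ncp; rewrite -xp.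
  exact/cinv_cdom/Sc.
apply: smooth_on_setU; last first.
  apply: (@eq_smooth_on _ _ _ (cst 0)).
  - exact: chart_image_open open_test_supportC.
  - by move=> _ [p [Sp cp'] <-]; rewrite /= cmapK// test_tensor0.
  - by apply: smooth_on_cst; exact: chart_image_open open_test_supportC.
have oU1 : open U1 by apply: chart_image_open; exact: cdom_open.
have tr f : smooth_in_chart c (cdom c) f -> smooth_on U1 (f \o cinv c').
  move=> sf; have := smooth_in_chart_transition ac ac' (cdom_open c) sf.
  by rewrite setIid.
apply: (@eq_smooth_on _ _ _ (fun x =>
  (\prod_a \sum_m jacobian_mx c c' (cinv c' x) m (tnth J a) *
     metric g c [tuple m; tnth K a] (cinv c' x)) * test_scalar (cinv c' x))) => //.
  by move=> _ [p [cp cp'] <-]; rewrite /= cmapK// test_tensorE.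
apply: smooth_onM => //; last exact: tr test_scalar_smooth.
apply: smooth_on_prod => // a; apply: smooth_on_sum => // m.
apply: smooth_onM => //; first exact: jacobian_smooth.
by apply: tr; exact: metric_in_chart.
Qed.

Lemma test_tensor_compact : compactly_supported test_tensor.
Proof.
exists test_support; first exact: compact_test_support.
by move=> c' J p _ _; exact: test_tensor0.
Qed.

Lemma nabla_test_tensor0 c' J p : atlas c' -> cdom c' p -> ~ test_support p ->
  nabla g test_tensor c' J p = 0.
Proof.
move=> ac' cp' Sp; rewrite /nabla (@eq_pderiv _ _ _ _ _ _ _ (cst 0) _ open_test_supportC)//.
  rewrite /pderiv (_ : cst 0 \o cinv c' = cst 0)// /partial derive_cst sub0r.
  rewrite big1 ?oppr0// => mu _; rewrite big1// => l _.
  by rewrite test_tensor0// mulr0.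
by move=> q Sq _; rewrite test_tensor0.
Qed.

Lemma test_scalar_is_derive i p : cdom c p ->
  is_derive (cmap c p) (delta_mx 0 i) (test_scalar \o cinv c) (pderiv c i test_scalar p).
Proof. by move=> cp; exact: pderiv_is_derive test_scalar_smooth _ _. Qed.

(** By Jacobi's formula the trace of the Christoffel symbols is the logarithmic
    derivative of the density. *)
Lemma vol_density_is_derive i p : cdom c p ->
  is_derive (cmap c p) (delta_mx 0 i) (vol_density g c)
    (vol_density g c (cmap c p) * \sum_l christoffel g c l l i p).
Proof.
move=> cp; have d0 := det_metric_gt0 g ac cp.
have D a b : is_derive (cmap c p) (delta_mx 0 i)
    (fun x => metric_mx g c (cinv c x) a b) (metric_pderiv g c p i a b).
  rewrite mxE (_ : (fun x => _) = metric g c [tuple a; b] \o cinv c).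
    by apply: pderiv_is_derive (metric_in_chart g _ ac) _ _.
  by apply/funext => x; rewrite mxE.
have D1 := is_derive_det D.
rewrite /= in D1.
have d0' : 0 < \det (metric_mx g c (cinv c (cmap c p))) by rewrite cmapK.
have D2 := is_derive_comp1 D1 (is_derive1_sqrt d0').
apply: (is_derive_eq D2); rewrite /vol_density cmapK//.
under eq_bigr do rewrite christoffelE.
rewrite trace_christoffel2; last 2 first.
- exact: metric_mx_sym.
- by move=> j; exact: metric_pderiv_sym.
set d := \det _ in d0 *.
have s0 : Num.sqrt d != 0 by rewrite gt_eqF// sqrtr_gt0.
have -> : \adj (metric_mx g c p) = d *: invmx (metric_mx g c p).
  by rewrite /invmx metric_mx_unit// scalerA mulfV ?gt_eqF// scale1r.
rewrite -scalemxAl mxtraceZ -[X in X * _ / _](sqr_sqrtr (ltW d0)).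
by field.
Qed.

(** The trace of the Christoffel symbols, which enters the divergence, is exactly
    compensated by the derivative of the density in [test_scalar]. *)
Lemma pderiv_test_scalar i p : cdom c p ->
  (pderiv c i test_scalar p + test_scalar p * \sum_l christoffel g c l l i p) *
  vol_density g c (cmap c p) = partial i psi (cmap c p).
Proof.
move=> cp; have cx : cimg c (cmap c p) by exists p.
have D := is_deriveM (test_scalar_is_derive i cp) (vol_density_is_derive i cp).
have [|_ E] := is_derive_open (cimg_open (c := c)) cx (g := psi) _ D.
  move=> x cx'; rewrite fctE /= /test_scalar cinvK// divfK//.
  by rewrite gt_eqF// vol_density_gt0.
by rewrite /partial E /GRing.scale/= cmapK//; ring.
Qed.

Lemma nabla_test_tensor j (J : k.-tuple 'I_n) p : cdom c p ->
  nabla g test_tensor c [tuple of j :: J] p =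
  lowered (metric_mx g c p) K J * pderiv c j test_scalar p +
  test_scalar p * \sum_mu \prod_a
    if a == mu then \sum_l christoffel2 (metric_mx g c p) (metric_pderiv g c p)
                             l j (tnth K a) * metric_mx g c p l (tnth J a)
    else metric_mx g c p (tnth J a) (tnth K a).
Proof.
move=> cp; rewrite -covariant_derivative_lowered; first last.
- by move=> l; exact: metric_pderiv_sym.
- exact: metric_mx_sym.
- exact: metric_mx_unit.
rewrite /nabla theadE behead_cons_tuple; congr (_ - _); last first.
  apply: eq_bigr => mu _; apply: eq_bigr => l _.
  by rewrite christoffelE test_tensor_chart.
have D a b : is_derive (cmap c p) (delta_mx 0 j)
    (metric g c [tuple a; b] \o cinv c) (metric_pderiv g c p j a b).
  by rewrite mxE; apply: pderiv_is_derive (metric_in_chart g _ ac) _ _.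
have D1 := is_derive_prod (fun a => D (tnth J a) (tnth K a)).
have D2 := is_deriveM D1 (test_scalar_is_derive j cp).
have cx : cimg c (cmap c p) by exists p.
have [|_ E] := is_derive_open (cimg_open (c := c)) cx (g := test_tensor c J \o cinv c) _ D2.
  move=> _ [q cq <-]; rewrite fctE /= cmapK// test_tensor_chart//.
  by congr (_ * _); apply: eq_bigr => a _; rewrite mxE.
rewrite /pderiv /partial E /GRing.scale/= cmapK//; congr (_ * _ + _ * _).
  by apply: eq_bigr => a _; rewrite mxE.
apply: eq_bigr => mu _; apply: eq_bigr => a _.
by case: ifP => // _; rewrite mxE.
Qed.
End TestTensor.

(** * Weak covariant derivative and weak partial derivatives *)

Section ChristoffelSmooth.
Variables (R : realType) (n : nat) (M : smooth_manifold R n).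
Variables (g : riemannian_metric M) (c : chart R n M) (ac : atlas c).

Lemma metric_mx_smooth i j :
  smooth_on (cimg c) (fun x => metric_mx g c (cinv c x) i j).
Proof.
under eq_fun do rewrite mxE.
by apply/smooth_in_chart_cimg; exact: metric_in_chart.
Qed.

Lemma inv_metric_smooth i j :
  smooth_on (cimg c) (fun x => inv_metric g c (cinv c x) i j).
Proof.
have oU := cimg_open (c := c).
have sw := inv_vol_density_smooth g ac.
apply: (@eq_smooth_on _ _ _ (fun x => ((vol_density g c x)^-1 * (vol_density g c x)^-1) *
  ((-1) ^+ (j + i) * \det (row' j (col' i (metric_mx g c (cinv c x))))))) => //.
  move=> x /cinv_cdom cx; rewrite /inv_metric /invmx metric_mx_unit// !mxE.
  rewrite /cofactor /vol_density -invfM -expr2 sqr_sqrtr//.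
  exact/ltW/det_metric_gt0.
apply: smooth_onM => //; first exact: smooth_onM.
apply: smooth_onM => //; first exact: smooth_on_cst.
apply: smooth_on_det => // a b.
by under eq_fun do rewrite mxE mxE; exact: metric_mx_smooth.
Qed.

Lemma christoffel_smooth l i j :
  smooth_on (cimg c) (fun x => christoffel g c l i j (cinv c x)).
Proof.
have oU := cimg_open (c := c).
have sd a b k : smooth_on (cimg c) (pderiv c k (metric g c [tuple a; b]) \o cinv c).
  apply/smooth_in_chart_cimg; apply: smooth_in_chart_pderiv; first exact: cdom_open.
  exact: metric_in_chart.
apply: smooth_onM => //; first exact: smooth_on_cst.
apply: smooth_on_sum => // m; apply: smooth_onM => //; first exact: inv_metric_smooth.
have sN f : smooth_on (cimg c) f -> smooth_on (cimg c) (fun x => - f x).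
  move=> sf; apply: (eq_smooth_on oU _ (smooth_onM oU (smooth_on_cst oU (-1)) sf)).
  by move=> x _; rewrite mulN1r.
apply: smooth_onD => //; last by apply: sN; exact: sd.
by apply: smooth_onD => //; exact: sd.
Qed.
End ChristoffelSmooth.

Section WeakFormula.
Variables (R : realType) (n : nat) (M : smooth_manifold R n).
Variables (g : riemannian_metric M) (Vol : {measure set (borel M) -> \bar R}).
Hypothesis volE : riemannian_volume g Vol.
Variables (c : chart R n M) (ac : atlas c).
Variables (psi : 'rV[R]_n -> R) (S : set 'rV[R]_n).
Hypotheses (spsi : smooth_on setT psi) (cS : compact S) (Sc : S `<=` cimg c).
Hypothesis psi0 : forall x, ~ S x -> psi x = 0.
Local Notation leb := (@lebesgue_rV R n).
Local Notation w := (vol_density g c).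

Lemma integral_supported_chart (F : M -> R) (f : 'rV[R]_n -> R) :
  measurable_fun (cimg c : set (borel 'rV[R]_n)) (f : borel 'rV[R]_n -> R) ->
  (forall p, ~ cdom c p -> F p = 0) ->
  (forall p, cdom c p -> F p * w (cmap c p) = f (cmap c p)) ->
  (\int[Vol]_p (F p)%:E = \int[leb]_(x in cimg c) (f x)%:E)%E.
Proof.
move=> mf F0 Ff.
transitivity (\int[Vol]_(p in cdom c) (F p)%:E)%E.
  rewrite [RHS]integral_mkcond; apply: eq_integral => p _; rewrite patchE.
  by case: ifPn => //; rewrite notin_setE => /F0 ->.
have cE : cdom c = cdom c `&` cmap c @^-1` (cimg c).
  by apply/seteqP; split=> [p cp|p []//]; split => //; exists p.
rewrite [in LHS]cE.
rewrite (eq_integral (fun p : borel M => ((fun x => f x * (w x)^-1) (cmap c p))%:E)); last first.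
  move=> p /[!inE] -[cp _]; rewrite -Ff// mulfK//.
  by rewrite gt_eqF// (vol_density_gt0 g ac)//; exists p.
have mfw : measurable_fun (cimg c : set (borel 'rV[R]_n))
    ((fun x => f x * (w x)^-1) : borel 'rV[R]_n -> R).
  apply: measurable_funM => //; apply: continuous_borelR; first exact: cimg_open.
  by move=> x /[!inE] cx; exact: smooth_on_continuous (inv_vol_density_smooth g ac) _ cx.
apply: etrans; first exact: (integral_chart volE ac (cimg_borel c) (subset_refl _) mfw).
apply: eq_integral => x /[!inE] cx; rewrite mulfVK//.
by rewrite gt_eqF// (vol_density_gt0 g ac).
Qed.

Lemma tensor_inner_test0 k (T : components M k) (K : k.-tuple 'I_n) p :
  ~ cdom c p -> tensor_inner g T (test_tensor g c psi K) p = 0.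
Proof.
move=> cp; rewrite /tensor_inner big1// => I _; rewrite big1// => J _.
by rewrite /test_tensor memNset// mulr0.
Qed.

(** The test tensor picks out one component of [T]. *)
Lemma tensor_inner_test k (T : components M k) (K : k.-tuple 'I_n) p :
  is_tensor T -> cdom c p ->
  tensor_inner g T (test_tensor g c psi K) p * w (cmap c p) = T c K p * psi (cmap c p).
Proof.
move=> tT cp; rewrite (tensor_inner_chart g tT (test_tensor_is_tensor g ac psi K) ac cp).
under [X in tinner _ _ X]funext do rewrite test_tensor_chart//.
rewrite tinner_lowered//; last exact: metric_mx_unit.
rewrite /test_scalar mulrA divfK// gt_eqF// (vol_density_gt0 g ac)//.
by exists p.
Qed.

Lemma tensor_inner_nabla_star_test0 k (T : components M k) (K : k.+1.-tuple 'I_n) p :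
  ~ cdom c p -> tensor_inner g T (nabla_star g (test_tensor g c psi K)) p = 0.
Proof.
move=> cp; rewrite /tensor_inner big1// => I _; rewrite big1// => J _.
have [ap pp] : atlas (chart_at p) /\ cdom (chart_at p) p.
  by rewrite /chart_at; case: cid2.
suff -> : nabla_star g (test_tensor g c psi K) (chart_at p) J p = 0 by rewrite mulr0.
rewrite /nabla_star big1 ?oppr0// => i _; rewrite big1// => j _.
rewrite (nabla_test_tensor0 g cS Sc psi0) ?mulr0// => -[x Sx xp]; apply: cp.
by rewrite -xp; exact/cinv_cdom/Sc.
Qed.

(** The formal adjoint on the test tensor, in the chart: the derivative falls on
    [psi], and the Christoffel terms fall on the indices of [T]. *)
Lemma tensor_inner_nabla_star_test k (T : components M k) i (I : k.-tuple 'I_n) p :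
  is_tensor T -> cdom c p ->
  tensor_inner g T (nabla_star g (test_tensor g c psi [tuple of i :: I])) p *
    w (cmap c p) =
  - (T c I p * partial i psi (cmap c p) +
     (\sum_(mu < k) \sum_l christoffel g c l i (tnth I mu) p *
        T c (subst_index I mu l) p) * psi (cmap c p)).
Proof.
move=> tT cp; set K := [tuple of i :: I].
have tN := nabla_star_tensor g (test_tensor_smooth g ac spsi cS Sc psi0 K).
rewrite (tensor_inner_chart g tT tN ac cp).
have -> : tinner (inv_metric g c p) (fun J => T c J p)
    (fun J => nabla_star g (test_tensor g c psi K) c J p) =
  - tinner (inv_metric g c p) (fun J => T c J p)
    (tcontract (inv_metric g c p) (fun L => nabla g (test_tensor g c psi K) c L p)).
  rewrite /tinner -sumrN; apply: eq_bigr => J _.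
  by rewrite -sumrN; apply: eq_bigr => L _; rewrite -mulrN.
rewrite (@tinner_divergence _ _ _ (metric_pderiv g c p) _ _ _ i I _ (test_scalar g c psi p)
  (fun j => pderiv c j (test_scalar g c psi) p)); first last.
- by move=> j J; rewrite (nabla_test_tensor g ac spsi).
- exact: metric_mx_sym.
- exact: metric_mx_unit.
rewrite mulNr mulrDl; congr (- (_ + _)).
  rewrite -mulrA -(pderiv_test_scalar g ac spsi i cp); congr (_ * (( _ + _ * _) * _)).
  by apply: eq_bigr => l _; rewrite christoffelE.
rewrite mulrAC /test_scalar divfK; last first.
  by rewrite gt_eqF// (vol_density_gt0 g ac)//; exists p.
rewrite mulrC; congr (_ * _); apply: eq_bigr => mu _; apply: eq_bigr => l _.
by rewrite christoffelE.
Qed.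
End WeakFormula.

Section IntegrationByParts.
Variables (R : realType) (d : measure_display) (T : measurableType d).
Variables (mu : {measure set T -> \bar R}) (U : set T) (mU : measurable U).
Variables (a b t v : T -> R).

(** Linearity of the integral; integrability allows the integrals of [a], [b] and
    [t] to be separated. *)
Lemma integral_rebalance : mu.-integrable U (EFin \o a) -> mu.-integrable U (EFin \o b) ->
  mu.-integrable U (EFin \o t) -> (forall x, U x -> v x = t x + b x) ->
  (\int[mu]_(x in U) (t x)%:E = \int[mu]_(x in U) (- (a x + b x))%:E)%E ->
  (\int[mu]_(x in U) (a x)%:E = - \int[mu]_(x in U) (v x)%:E)%E.
Proof.
move=> ia ib it vE E.
have -> : (\int[mu]_(x in U) (v x)%:E =
    \int[mu]_(x in U) (t x)%:E + \int[mu]_(x in U) (b x)%:E)%E.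
  rewrite -integralD_EFin//; apply: eq_integral => x /[!inE] Ux.
  by rewrite vE// EFinD.
have iab : mu.-integrable U (fun x => (a x + b x)%:E).
  exact: (integrableD mU ia ib).
have -> : (\int[mu]_(x in U) (t x)%:E =
    - (\int[mu]_(x in U) (a x)%:E + \int[mu]_(x in U) (b x)%:E))%E.
  rewrite E -integralD_EFin//.
  rewrite (eq_integral (fun x => - (a x + b x)%:E)%E)// integralN//.
  exact: integrable_add_def iab.
have fa := integrable_fin_num mU ia; have fb := integrable_fin_num mU ib.
rewrite /= in fa fb.
rewrite -(fineK fa) -(fineK fb).
set ra := fine _; set rb := fine _.
by apply: (congr1 EFin (x := ra) (y := - (- (ra + rb) + rb))); ring.
Qed.
End IntegrationByParts.

Theorem corollary1p2 (R : realType) (n q : nat) (M : smooth_manifold R n)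
    (g : riemannian_metric M) (Vol : {measure set (borel M) -> \bar R})
    (c : chart R n M) (alpha : components M q) (tau : components M q.+1) :
  orientable M ->
  riemannian_volume g Vol ->
  (1 <= q)%N ->
  atlas c ->
  is_form alpha ->
  L1loc_tensor Vol alpha ->
  weak_covariant_derivative g Vol alpha tau ->
  exists dalpha : 'I_n -> q.-tuple 'I_n -> 'rV[R]_n -> R,
    (forall (i : 'I_n) (I : q.-tuple 'I_n),
      weak_partial (cimg c) i (alpha c I \o cinv c) (dalpha i I)) /\
    (forall (i : 'I_n) (I : q.-tuple 'I_n), {ae Vol, forall p, cdom c p ->
      tau c [tuple of i :: I] p =
      dalpha i I (cmap c p) -
      \sum_(mu < q) \sum_(l < n)
        christoffel g c l i (tnth I mu) p * alpha c (subst_index I mu l) p}).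
Proof.
move=> _ volE _ ac _ [talpha Lalpha] [[ttau Ltau] weak].
pose corr (i : 'I_n) (I : q.-tuple 'I_n) (p : M) := \sum_(mu < q) \sum_(l < n)
  christoffel g c l i (tnth I mu) p * alpha c (subst_index I mu l) p.
pose dalpha (i : 'I_n) (I : q.-tuple 'I_n) (x : 'rV[R]_n) :=
  tau c [tuple of i :: I] (cinv c x) + corr i I (cinv c x).
exists dalpha; split=> i I; last first.
  by apply: aeW => p cp; rewrite /dalpha cmapK// addrK.
have oU := cimg_open (c := c).
have hT : hausdorff_space 'rV[R]_n by exact: norm_hausdorff.
have La J : L1loc_on (@lebesgue_rV R n) (cimg c) (alpha c J \o cinv c).
  exact: (L1loc_chart volE ac (Lalpha c J ac)).
have Lt : L1loc_on (@lebesgue_rV R n) (cimg c) (tau c [tuple of i :: I] \o cinv c).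
  exact: (L1loc_chart volE ac (Ltau c _ ac)).
have Lc : L1loc_on (@lebesgue_rV R n) (cimg c) (corr i I \o cinv c).
  apply: (L1loc_on_sum hT oU (f := fun mu x => \sum_(l < n)
    christoffel g c l i (tnth I mu) (cinv c x) *
    alpha c (subst_index I mu l) (cinv c x))) => // mu.
  apply: (L1loc_on_sum hT oU (f := fun l x =>
    christoffel g c l i (tnth I mu) (cinv c x) *
    alpha c (subst_index I mu l) (cinv c x))) => // l.
  apply: (L1loc_onM hT oU _ (La _)) => x /[!inE] cx.
  exact: smooth_on_continuous (christoffel_smooth g ac l i (tnth I mu)) _ cx.
(* [dalpha] is the sum of the component of [tau] and of the Christoffel terms *)
split=> //; first exact: (L1loc_onD hT oU Lt Lc).
move=> psi [spsi [S [cS Sc psi0]]].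
have cpsi : {in cimg c, continuous psi}.
  by move=> x _; exact: smooth_on_continuous spsi _ _.
have cdpsi : {in cimg c, continuous (partial i psi)}.
  by move=> x _; exact: smooth_on_continuous (smooth_on_partial i spsi) _ _.
have dpsi0 x : ~ S x -> partial i psi x = 0.
  move=> Sx; have oS : open (~` S) by apply: closed_openC; exact: compact_closed cS.
  have := is_derive_cst (0 : R) x (delta_mx 0 i : 'rV[R]_n).
  move=> /(is_derive_open oS Sx (g := psi)) [|//].
  by move=> y Sy; rewrite psi0.
apply: (@integral_rebalance _ _ _ _ _ (cimg_borel c) _
  (fun x => corr i I (cinv c x) * psi x)
  (fun x => tau c [tuple of i :: I] (cinv c x) * psi x)).
- exact: (L1loc_on_integrable hT oU (La I) cdpsi cS Sc dpsi0).
- exact: (L1loc_on_integrable hT oU Lc cpsi cS Sc psi0).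
- exact: (L1loc_on_integrable hT oU Lt cpsi cS Sc psi0).
- by move=> x _; rewrite -mulrDl.
have mpsi := continuous_borelR oU cpsi.
have mdpsi := continuous_borelR oU cdpsi.
set K := [tuple of i :: I].
have := weak _ (test_tensor_smooth g ac spsi cS Sc psi0 K) (test_tensor_compact g cS Sc psi0 K).
rewrite (@integral_supported_chart _ _ _ g _ volE c ac _
  (fun x => tau c K (cinv c x) * psi x)); first last.
- by move=> p cp; rewrite tensor_inner_test// cmapK.
- by move=> p; exact: tensor_inner_test0.
- by apply: measurable_funM => //; case: Lt.
rewrite (@integral_supported_chart _ _ _ g _ volE c ac _
  (fun x => - (alpha c I (cinv c x) * partial i psi x + corr i I (cinv c x) * psi x))).
- by [].
- apply: measurableT_comp => //; apply: measurable_funD; apply: measurable_funM => //.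
    by case: (La I).
  by case: Lc.
- by move=> p; exact: (tensor_inner_nabla_star_test0 g cS Sc psi0).
- move=> p cp; rewrite (tensor_inner_nabla_star_test g ac spsi cS Sc psi0 i I talpha cp).
  by rewrite /corr cmapK.
Qed.
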